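(* Let $q\ge1$ and let $\gamma:I\to\mathbb{C}P^1(4)$ be a curve parametrized by arc length with nowhere zero curvature $\kappa$. Let $M^{1+2q}=\gamma\times\mathbb{C}P^q(4)$, regarded as a submanifold of $\mathbb{C}P^{1+2q}(4)$ via the composition of the inclusion $\gamma\times\mathbb{C}P^q(4)\to\mathbb{C}P^1(4)\times\mathbb{C}P^q(4)$ with the Segre embedding $\mathbb{C}P^1(4)\times\mathbb{C}P^q(4)\to\mathbb{C}P^{1+2q}(4)$. Then: (1) $M^{1+2q}$ is a biconservative submanifold of $\mathbb{C}P^{1+2q}(4)$ if and only if $\kappa$ is constant; in this case $M^{1+2q}$ is CMC and not PMC, and moreover it is not totally real. (2) $M^{1+2q}$ is a proper-biharmonic submanifold of $\mathbb{C}P^{1+2q}(4)$ if and only if $\kappa^2=4$, i.e. if and only if $\gamma$ is proper-biharmonic in $\mathbb{C}P^1(4)$.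
   Context: $\mathbb{C}P^n(4)$ is complex projective space of complex dimension $n$ with the Fubini–Study metric of constant holomorphic sectional curvature $4$ and complex structure $J$ ($\mathbb{C}P^1(4)$ is isometric to the round $2$-sphere of curvature $4$). The Segre embedding is the holomorphic isometric embedding $([z_i]_{i=0,1},[w_j]_{0\le j\le q})\mapsto[z_iw_j]$. The curvature $\kappa$ is defined by $\nabla_{\gamma'}\gamma'=\kappa\mathbf n$ with $\mathbf n$ the unit normal of the Frenet frame $\{\gamma',\mathbf n\}$. For a submanifold (isometric immersion) $\phi:M^m\to N$, $B$ is the second fundamental form, $H=\frac1m\operatorname{trace}B$ the mean curvature vector field, $\nabla^\perp$ the normal connection. $M$ is CMC if $|H|$ is constant, PMC if $\nabla^\perp H=0$, totally real if $J(TM)$ is contained in the normal bundle of $M$. The tension field is $\tau(\phi)=\operatorname{trace}\nabla d\phi=mH$ and the bitension field is $\tau_2(\phi)=-\Delta\tau(\phi)-\operatorname{trace}\overline R(d\phi(\cdot),\tau(\phi))d\phi(\cdot)$, where $\Delta=-\operatorname{trace}\nabla^2$ and $\overline R(X,Y)Z=\overline\nabla_X\overline\nabla_YZ-\overline\nabla_Y\overline\nabla_XZ-\overline\nabla_{[X,Y]}Z$ is the curvature tensor of $N$. $M$ (or a curve, $m=1$) is biharmonic if $\tau_2(\phi)=0$, proper-biharmonic if biharmonic and not harmonic ($\tau(\phi)\not\equiv0$), and biconservative if the tangential part of $\tau_2(\phi)$ vanishes. *)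

(* Defs.v *)
From HB Require Import structures.
From mathcomp Require Import all_boot all_order all_algebra.
From mathcomp Require Import all_classical all_reals all_analysis.
From mathcomp Require Export complex mxtens.

Set Implicit Arguments.
Unset Strict Implicit.
Unset Printing Implicit Defensive.
Import Order.TTheory GRing.Theory Num.Theory.
Import numFieldNormedType.Exports.
Local Open Scope classical_set_scope.
Local Open Scope ring_scope.

Record euclid (R : realType) := Euclid {
  evec :> lmodType R;
  edot : evec -> evec -> R;
  eidx : finType;
  ebasis : eidx -> evec;
  edotC : forall u v, edot u v = edot v u;
  edotDl : forall u v w, edot (u + v) w = edot u w + edot v w;
  edotZl : forall a u v, edot (a *: u) v = a * edot u v;
  ebasis_orthonormal : forall i j, edot (ebasis i) (ebasis j) = (i == j)%:R;
  ebasis_expansion : forall v, v = \sum_i edot v (ebasis i) *: ebasis i }.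

Arguments edot {R e} u v.
Arguments ebasis {R e} i.

Section Curves.
Variables (R : realType) (E : euclid R).

Definition enorm (v : E) : R := Num.sqrt (edot v v).

Definition ederiv (f : R -> E) (t : R) : E :=
  \sum_i derive1 (fun s => edot (f s) (ebasis i)) t *: ebasis i.

Definition ederivable (f : R -> E) (t : R) : Prop :=
  forall i, derivable (fun s => edot (f s) (ebasis i)) t 1.

Definition smooth_on (I : set R) (f : R -> E) : Prop :=
  forall (i : eidx E) (k : nat) (t : R), I t ->
    derivable (derive1n k (fun s => edot (f s) (ebasis i))) t 1.

End Curves.

(* A submanifold of a Euclidean space, with the induced Riemannian metric.
   [tproj p] is the orthogonal projection of the ambient space onto the tangent
   space at [p], and, for [x] tangent at [p], [curve p x] is a curve on the
   submanifold starting at [p] with velocity [x].  Functions on the submanifold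
   are functions on the ambient space of which only the values on [points]
   matter: they are differentiated along the curves [curve p x]. *)
Record manifold (R : realType) := Manifold {
  ambient : euclid R;
  points : set ambient;
  mdim : nat;
  tproj : ambient -> ambient -> ambient;
  curve : ambient -> ambient -> R -> ambient;
  tproj_idem : forall p v, points p -> tproj p (tproj p v) = tproj p v;
  tproj_sym : forall p v w, points p ->
    edot (tproj p v) w = edot v (tproj p w);
  curve0 : forall p x, points p -> curve p x 0 = p;
  curve_in : forall p x, points p -> tproj p x = x ->
    \forall s \near 0, points (curve p x s);
  curve_velocity : forall p x, points p -> tproj p x = x ->
    ederivable (curve p x) 0 /\ ederiv (curve p x) 0 = x }.

Arguments points {R} m p.
Arguments mdim {R} m.
Arguments tproj {R m} p v.
Arguments curve {R m} p x s.

Section Geometry.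
Variable R : realType.
Implicit Types M N : manifold R.

Definition dirder M (F : euclid R) (V : ambient M -> F) (p x : ambient M) : F :=
  ederiv (fun s => V (curve p x s)) 0.

(* The vector field [p |-> tproj p y] extends any vector tangent to [M]. *)
Definition tfield M (y : ambient M) : ambient M -> ambient M := fun p => tproj p y.

(* If [B] is tensorial in its two vector field arguments, then the vectors
   [tproj p (ebasis i)] compute its metric trace on the tangent space at [p],
   since [tproj p] is an orthogonal projection. *)
Definition mtrace M (F : euclid R)
    (B : (ambient M -> ambient M) -> (ambient M -> ambient M) -> ambient M -> F)
    (p : ambient M) : F :=
  \sum_(i : eidx (ambient M)) B (tfield (ebasis i)) (tfield (ebasis i)) p.

Definition dmap M N (phi : ambient M -> ambient N) (X : ambient M -> ambient M)
    (p : ambient M) : ambient N := dirder phi p (X p).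

(* The pull-back by [phi] of the Levi-Civita connection of [N], on vector
   fields [V] along [phi]. *)
Definition pconn M N (phi : ambient M -> ambient N) (X : ambient M -> ambient M)
    (V : ambient M -> ambient N) (p : ambient M) : ambient N :=
  tproj (phi p) (dirder V p (X p)).

Definition conn M (X Y : ambient M -> ambient M) : ambient M -> ambient M :=
  pconn idfun X Y.

Definition bracket M (X Y : ambient M -> ambient M) (p : ambient M) : ambient M :=
  dirder Y p (X p) - dirder X p (Y p).

Definition curvature_field M (X Y Z : ambient M -> ambient M) (p : ambient M) :
    ambient M :=
  conn X (conn Y Z) p - conn Y (conn X Z) p - conn (bracket X Y) Z p.

Definition curvature M (p x y z : ambient M) : ambient M :=
  curvature_field (tfield x) (tfield y) (tfield z) p.

(* [nabla (d phi)]; by the Gauss formula, the second fundamental form [B] when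
   [phi] is an isometric immersion. *)
Definition sff M N (phi : ambient M -> ambient N) (X Y : ambient M -> ambient M)
    (p : ambient M) : ambient N :=
  pconn phi X (dmap phi Y) p - dmap phi (conn X Y) p.

Definition tension M N (phi : ambient M -> ambient N) : ambient M -> ambient N :=
  mtrace (sff phi).

Definition mean_curvature M N (phi : ambient M -> ambient N) (p : ambient M) :
    ambient N :=
  (mdim M)%:R^-1 *: mtrace (sff phi) p.

Definition hessian M N (phi : ambient M -> ambient N) (V : ambient M -> ambient N)
    (X Y : ambient M -> ambient M) (p : ambient M) : ambient N :=
  pconn phi X (pconn phi Y V) p - pconn phi (conn X Y) V p.

Definition laplacian M N (phi : ambient M -> ambient N) (V : ambient M -> ambient N)
    (p : ambient M) : ambient N :=
  - mtrace (hessian phi V) p.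

Definition bitension M N (phi : ambient M -> ambient N) (p : ambient M) : ambient N :=
  - laplacian phi (tension phi) p
  - mtrace (fun X Y q =>
      curvature (phi q) (dmap phi X q) (tension phi q) (dmap phi Y q)) p.

(* For an isometric immersion [phi], the orthogonal projection of [V p] onto
   the image of the tangent space at [p]. *)
Definition tangential M N (phi : ambient M -> ambient N) (V : ambient M -> ambient N)
    (p : ambient M) : ambient N :=
  mtrace (fun X Y q => edot (V q) (dmap phi X q) *: dmap phi Y q) p.

Definition normal_conn M N (phi : ambient M -> ambient N) (X : ambient M -> ambient M)
    (V : ambient M -> ambient N) (p : ambient M) : ambient N :=
  pconn phi X V p - tangential phi (pconn phi X V) p.

Definition harmonic_map M N (phi : ambient M -> ambient N) : Prop :=
  forall p, points M p -> tension phi p = 0.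

Definition biharmonic M N (phi : ambient M -> ambient N) : Prop :=
  forall p, points M p -> bitension phi p = 0.

Definition proper_biharmonic M N (phi : ambient M -> ambient N) : Prop :=
  biharmonic phi /\ ~ harmonic_map phi.

Definition biconservative M N (phi : ambient M -> ambient N) : Prop :=
  forall p, points M p -> tangential phi (bitension phi) p = 0.

Definition CMC M N (phi : ambient M -> ambient N) : Prop :=
  exists c : R, forall p, points M p -> enorm (mean_curvature phi p) = c.

Definition PMC M N (phi : ambient M -> ambient N) : Prop :=
  forall p x, points M p ->
    normal_conn phi (tfield x) (mean_curvature phi) p = 0.

Definition totally_real M N (J : ambient N -> ambient N -> ambient N)
    (phi : ambient M -> ambient N) : Prop :=
  forall p x y, points M p ->
    edot (J (phi p) (dmap phi (tfield x) p)) (dmap phi (tfield y) p) = 0.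

End Geometry.

Lemma edot_ext (R : realType) (E : euclid R) (u v : E) :
  (forall i, edot u (ebasis i) = edot v (ebasis i)) -> u = v.
Proof.
move=> uv; rewrite (ebasis_expansion u) (ebasis_expansion v).
by apply: eq_bigr => i _; rewrite uv.
Qed.

Lemma edot0 (R : realType) (E : euclid R) (v : E) : edot 0 v = 0.
Proof. by rewrite -(scale0r (0 : E)) edotZl mul0r. Qed.

Lemma edot0r (R : realType) (E : euclid R) (v : E) : edot v 0 = 0.
Proof. by rewrite edotC edot0. Qed.

Lemma edot_suml (R : realType) (E : euclid R) (I : finType) (F : I -> E) v :
  edot (\sum_i F i) v = \sum_i edot (F i) v.
Proof.
by elim/big_rec2: _ => [|i x y _ <-]; rewrite ?edot0 ?edotDl.
Qed.

Lemma edot_ederiv (R : realType) (E : euclid R) (f : R -> E) t i :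
  edot (ederiv f t) (ebasis i) = derive1 (fun s => edot (f s) (ebasis i)) t.
Proof.
rewrite /ederiv edot_suml (bigD1 i) //= edotZl ebasis_orthonormal eqxx mulr1.
rewrite big1 ?addr0 // => j ji.
by rewrite edotZl ebasis_orthonormal (negbTE ji) mulr0.
Qed.

Lemma curve_velocity_coord (R : realType) (E : euclid R) (f : R -> E) x :
  (forall i, is_derive (0 : R) (1 : R) (fun s => edot (f s) (ebasis i))
     (edot x (ebasis i))) ->
  ederivable f 0 /\ ederiv f 0 = x.
Proof.
move=> df; split=> [i|]; first by have [] := df i.
by apply: edot_ext => i; rewrite edot_ederiv derive1E; have [_] := df i.
Qed.

Lemma rational_velocity (R : realType) (a b c d : R) :
  is_derive (0 : R) (1 : R)
    (fun s => (1 + s ^+ 2 * d)^-1 * (a + s * b + s ^+ 2 * c)) b.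
Proof.
have d0 : 1 + (0 : R) ^+ 2 * d != 0 by rewrite expr0n /= mul0r addr0 oner_neq0.
have Dg : is_derive (0 : R) (1 : R) (fun s : R => 1 + s ^+ 2 * d) 0.
  apply: is_derive_eq.
  by rewrite /GRing.scale /= !(mulr0, mul0r, addr0).
have Dg' : is_derive (0 : R) (1 : R) (fun s : R => (1 + s ^+ 2 * d)^-1) 0.
  have [dg eg] := Dg; apply: DeriveDef; first exact: derivableV.
  by rewrite deriveV // eg scaler0.
have Dh : is_derive (0 : R) (1 : R) (fun s : R => a + s * b + s ^+ 2 * c) b.
  apply: is_derive_eq; rewrite /GRing.scale /=.
  by rewrite !(mulr0, mul0r, addr0, add0r, mul1r, mulr1).
apply: (is_derive_eq (is_deriveM Dg' Dh)); rewrite /GRing.scale /=.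
by rewrite !(expr0n, mulr0, mul0r, addr0, add0r, invr1, mul1r).
Qed.

Section RealLine.
Variable R : realType.

Program Definition real_line : euclid R :=
  @Euclid R R^o (fun x y => x * y) unit (fun=> 1) _ _ _ _ _.
Next Obligation. by move=> x y; exact: mulrC. Qed.
Next Obligation. by move=> x y z; exact: mulrDl. Qed.
Next Obligation. by move=> a x y; rewrite /GRing.scale /= mulrA. Qed.
Next Obligation. by move=> [] []; rewrite mulr1. Qed.
Next Obligation.
by move=> v; rewrite (big_pred1 tt) => [|[]] //; rewrite mulr1 /GRing.scale /= mulr1.
Qed.

Program Definition open_interval (I : set R) (oI : open I) : manifold R :=
  @Manifold R real_line I 1 (fun _ x => x) (fun t x s => t + s * x) _ _ _ _ _.
Next Obligation. by []. Qed.
Next Obligation. by []. Qed.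
Next Obligation. by move=> I oI t x _ /=; rewrite mul0r addr0. Qed.
Next Obligation.
move=> I oI t x It _ /=.
have c : (fun s : R => t + s * x) @ (0 : R) --> t + 0 * x.
  by apply: cvgD; [exact: cvg_cst|apply: cvgMl; exact: cvg_id].
rewrite mul0r addr0 in c; apply: (c I); exact: open_nbhs_nbhs.
Qed.
Next Obligation.
move=> I oI t x It _; apply: curve_velocity_coord => i /=.
rewrite mulr1; under eq_fun do rewrite mulr1.
by apply: is_derive_eq; rewrite add0r mul1r scaler0 add0r /GRing.scale /= mulr1.
Qed.

End RealLine.

Section Product.
Variable R : realType.

Program Definition euclid_prod (E F : euclid R) : euclid R :=
  @Euclid R (E * F)%type (fun u v => edot u.1 v.1 + edot u.2 v.2)
    (eidx E + eidx F)%type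
    (fun i => match i with inl j => (ebasis j, 0) | inr j => (0, ebasis j) end)
    _ _ _ _ _.
Next Obligation. by move=> E F u v /=; rewrite edotC (edotC u.2). Qed.
Next Obligation. by move=> E F u v w /=; rewrite !edotDl addrACA. Qed.
Next Obligation. by move=> E F a u v /=; rewrite !edotZl mulrDr. Qed.
Next Obligation.
move=> E F [] i [] j /=; rewrite ?edot0 ?edot0r ?addr0 ?add0r //=;
  by rewrite ebasis_orthonormal.
Qed.
Next Obligation.
move=> E F [u v] /=; rewrite big_sumType /=.
under eq_bigr do rewrite edot0r addr0.
under [X in _ + X]eq_bigr do rewrite edot0r add0r.
rewrite [RHS]surjective_pairing /= !raddf_sum /=.
congr (_, _).
  rewrite [X in _ + X]big1 => [|i _]; last by rewrite scaler0.
  by rewrite addr0 -ebasis_expansion.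
rewrite [X in X + _]big1 => [|i _]; last by rewrite scaler0.
by rewrite add0r -ebasis_expansion.
Qed.

Program Definition manifold_prod (M N : manifold R) : manifold R :=
  @Manifold R (euclid_prod (ambient M) (ambient N))
    [set p | points M p.1 /\ points N p.2] (mdim M + mdim N)
    (fun p v => (tproj p.1 v.1, tproj p.2 v.2))
    (fun p x s => (curve p.1 x.1 s, curve p.2 x.2 s)) _ _ _ _ _.
Next Obligation. by move=> M N p v [? ?] /=; rewrite !tproj_idem. Qed.
Next Obligation. by move=> M N p v w [? ?] /=; rewrite !tproj_sym. Qed.
Next Obligation. by move=> M N [p q] x [? ?] /=; rewrite !curve0. Qed.
Next Obligation.
move=> M N [p q] [x y] /= [Mp Nq] [xp yq].
by near=> s; split; near: s; exact: curve_in.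
Unshelve. all: by end_near. Qed.
Next Obligation.
move=> M N [p q] [x y] /= [Mp Nq] [xp yq]; apply: curve_velocity_coord => -[] i /=.
  rewrite edot0r addr0; under eq_fun do rewrite edot0r addr0.
  have [d e] := curve_velocity Mp xp.
  apply: DeriveDef; first exact: d.
  by rewrite -derive1E -edot_ederiv e.
rewrite edot0r add0r; under eq_fun do rewrite edot0r add0r.
have [d e] := curve_velocity Nq yq.
apply: DeriveDef; first exact: d.
by rewrite -derive1E -edot_ederiv e.
Qed.

End Product.

Section ProjectiveSpace.
Variable R : realType.
Local Notation C := R[i].
Local Open Scope complex_scope.

Definition cmx (n : nat) := 'M[C]_n.
HB.instance Definition _ n := GRing.Zmodule.on (cmx n).

Section Lmodule.
Variable n : nat.
Implicit Types A B : cmx n.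

Definition cmx_scale (a : R) A : cmx n := a%:C *: (A : 'M[C]_n).

Fact cmx_scaleA a b A : cmx_scale a (cmx_scale b A) = cmx_scale (a * b) A.
Proof. by rewrite /cmx_scale scalerA rmorphM. Qed.
Fact cmx_scale1 : left_id 1 cmx_scale.
Proof. by move=> A; rewrite /cmx_scale rmorph1 scale1r. Qed.
Fact cmx_scaleDr : right_distributive cmx_scale +%R.
Proof. by move=> a A B; rewrite /cmx_scale scalerDr. Qed.
Fact cmx_scaleDl A : {morph cmx_scale^~ A : a b / a + b}.
Proof. by move=> a b; rewrite /cmx_scale rmorphD scalerDl. Qed.
HB.instance Definition _ := GRing.Zmodule_isLmodule.Build R (cmx n)
  cmx_scaleA cmx_scale1 cmx_scaleDr cmx_scaleDl.
End Lmodule.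

Definition ctr m n (A : 'M[C]_(m, n)) : 'M[C]_(n, m) := (map_mx conjc A)^T.

(* On tangent vectors of P(C^n), this is the Fubini-Study metric of
   holomorphic sectional curvature 4; see [cmx_dot_horizontal]. *)
Definition cmx_dot n (A B : 'M[C]_n) : R := 2^-1 * complex.Re (\tr (A *m ctr B)).

Lemma cmx_dotE n (A B : 'M[C]_n) : cmx_dot A B =
  2^-1 * \sum_i \sum_j (complex.Re (A i j) * complex.Re (B i j)
                        + complex.Im (A i j) * complex.Im (B i j)).
Proof.
rewrite /cmx_dot /mxtrace; congr (_ * _).
rewrite (raddf_sum (@complex.Re R : Rcomplex R -> R)); apply: eq_bigr => i _.
rewrite mxE (raddf_sum (@complex.Re R : Rcomplex R -> R)); apply: eq_bigr => j _.
by rewrite !mxE; case: (A i j) (B i j) => [a b] [c d] /=; rewrite mulrN opprK.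
Qed.

Definition cmx_basis n (k : 'I_n * 'I_n * bool) : cmx n :=
  ((Num.sqrt 2)%:C * (if k.2 then 'i%C else 1)) *: delta_mx k.1.1 k.1.2.

Lemma cmx_dot_basis n (A : 'M[C]_n) k : cmx_dot A (cmx_basis k) =
  (Num.sqrt 2)^-1 * (if k.2 then @complex.Im R else @complex.Re R) (A k.1.1 k.1.2).
Proof.
have h : 2^-1 * Num.sqrt 2 = (Num.sqrt 2)^-1 :> R.
  have s0 : Num.sqrt 2 != 0 :> R by rewrite sqrtr_eq0 -ltNge.
  by apply: (mulIf s0); rewrite mulVf // -mulrA -expr2 sqr_sqrtr // mulVf ?pnatr_eq0.
case: k => [[i j] b] /=; rewrite cmx_dotE (bigD1 i) //= (bigD1 j) //=.
rewrite !big1 ?addr0.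
- rewrite !mxE !eqxx /= mulr1 -h -mulrA; congr (_ * _).
  by case: b; case: (A i j) => [x y] /=;
    rewrite ?(oppr0, mulr0, mulr1, mul0r, mul1r, subr0, addr0, add0r) mulrC.
- move=> k ki; apply: big1 => l _; rewrite !mxE (negbTE ki) /= mulr0 /=.
  by rewrite !mulr0 addr0.
- by move=> l lj; rewrite !mxE (negbTE lj) andbF mulr0 /= !mulr0 addr0.
Qed.

Program Definition cmx_euclid (n : nat) : euclid R :=
  @Euclid R (cmx n) (@cmx_dot n) ('I_n * 'I_n * bool)%type (@cmx_basis n)
    _ _ _ _ _.
Next Obligation.
move=> n A B; rewrite !cmx_dotE; congr (_ * _).
apply: eq_bigr => i _; apply: eq_bigr => j _.
by rewrite mulrC [X in _ + X]mulrC.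
Qed.
Next Obligation.
move=> n A B D; rewrite /cmx_dot mulmxDl mxtraceD.
by rewrite (raddfD (@complex.Re R : Rcomplex R -> R)) mulrDr.
Qed.
Next Obligation.
move=> n a A B; rewrite /cmx_dot -scalemxAl mxtraceZ mulrCA; congr (_ * _).
by case: (\tr _) => x y /=; rewrite mul0r subr0.
Qed.
Next Obligation.
move=> n [[i j] b] [[k l] c]; rewrite cmx_dot_basis /= !mxE.
have s0 : Num.sqrt 2 != 0 :> R by rewrite sqrtr_eq0 -ltNge.
rewrite !xpair_eqE [k == i]eq_sym [l == j]eq_sym.
case: (i == k) (j == l) => [] [] //=; case: b c => [] [] /=;
  rewrite ?(mulr0, mulr1, mul0r, mul1r, subr0, addr0, add0r, oppr0) ?mulVf //.
Qed.
Next Obligation.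
move=> n A; apply/matrixP => i j; rewrite summxE.
have s0 : Num.sqrt 2 != 0 :> R by rewrite sqrtr_eq0 -ltNge.
have sC (x : R) : (((Num.sqrt 2)^-1 * x)%:C * (Num.sqrt 2)%:C = x%:C :> C)%R.
  by rewrite -rmorphM /= mulrC mulrA mulfV // mul1r.
rewrite (bigD1 (i, j, true)) //= (bigD1 (i, j, false)) /=; last by rewrite xpair_eqE andbF.
rewrite big1 => [|k].
  rewrite !cmx_dot_basis /= !mxE !eqxx /= !mulr1 !mulrA !sC addr0 addrC.
  by case: (A i j) => x y; rewrite [LHS]complexE /= [_ * 'i%C]mulrC.
case: k => [[k l] b] /andP[k1 k2]; rewrite cmx_dot_basis !mxE /=.
case: eqP => [ik|]; case: eqP => [jl|] /=; rewrite ?mulr0 //.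
by move: k1 k2; rewrite -ik -jl; case: b; rewrite eqxx.
Qed.

Lemma ctrM m n p (A : 'M[C]_(m, n)) (B : 'M[C]_(n, p)) :
  ctr (A *m B) = ctr B *m ctr A.
Proof. by rewrite /ctr map_mxM trmx_mul. Qed.

Lemma ctrK m n (A : 'M[C]_(m, n)) : ctr (ctr A) = A.
Proof. by apply/matrixP => i j; rewrite !mxE conjcK. Qed.

(* The line spanned by [z], i.e. the point [z] in homogeneous coordinates. *)
Definition line n (z : 'cV[C]_n) : cmx n :=
  (\tr (z *m ctr z))^-1 *: (z *m ctr z).

Definition PC_points n : set (cmx n) :=
  [set P | exists2 z : 'cV[C]_n, z != 0 & P = line z].

Definition herm n (A : 'M[C]_n) : 'M[C]_n := 2^-1 *: (A + ctr A).

Definition PC_tproj n (P A : cmx n) : cmx n :=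
  P *m herm A *m (1%:M - P) + (1%:M - P) *m herm A *m P.

(* If [P] is the projector onto a line [l], the projector onto the line
   [(1 + s A) l]. *)
Definition PC_curve n (P A : cmx n) (s : R) : cmx n :=
  let U : 'M[C]_n := 1%:M + s%:C *: (A : 'M[C]_n) in
  let Q := U *m P *m ctr U in (\tr Q)^-1 *: Q.

(* In terms of unit vectors [z], the complex structure is [w |-> 'i%C *: w] on
   the horizontal vectors [w]; see [PC_J_horizontal]. *)
Definition PC_J n (P A : cmx n) : cmx n := 'i%C *: (A *m P - P *m A).

Lemma ctrD m n (A B : 'M[C]_(m, n)) : ctr (A + B) = ctr A + ctr B.
Proof. by rewrite /ctr map_mxD linearD. Qed.

Lemma ctrB m n (A B : 'M[C]_(m, n)) : ctr (A - B) = ctr A - ctr B.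
Proof. by rewrite /ctr map_mxB linearB. Qed.

Lemma ctrZ m n a (A : 'M[C]_(m, n)) : ctr (a *: A) = conjc a *: ctr A.
Proof. by rewrite /ctr map_mxZ linearZ. Qed.

Lemma ctr1 n : ctr 1%:M = 1%:M :> 'M[C]_n.
Proof. by rewrite /ctr map_mx1 trmx1. Qed.

Lemma conjc_real (a : R) : conjc a%:C = a%:C.
Proof. by rewrite /= oppr0. Qed.

Lemma conjc_half : conjc (2^-1 : C) = 2^-1.
Proof. by rewrite fmorphV rmorph_nat. Qed.

Lemma tr_ctr n (A : 'M[C]_n) : \tr (ctr A) = conjc (\tr A).
Proof. by rewrite /mxtrace rmorph_sum; apply: eq_bigr => i _; rewrite !mxE. Qed.

Lemma tr_real n (A : 'M[C]_n) : ctr A = A -> \tr A = (complex.Re (\tr A))%:C.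
Proof.
move=> hA; have := tr_ctr A; rewrite hA; case: (\tr A) => x y /= [] /eqP.
by rewrite -addr_eq0 -mulr2n mulrn_eq0 /= => /eqP ->.
Qed.

Section Line.
Variables (n : nat) (z : 'cV[C]_n).
Hypothesis z0 : z != 0.

Lemma norm_neq0 : \tr (z *m ctr z) != 0.
Proof.
apply: contra_neq z0; rewrite /mxtrace.
under eq_bigr do rewrite mxE big_ord_recl big_ord0 addr0 !mxE.
move=> /eqP; rewrite psumr_eq0 => [/allP h|i _]; last first.
  by case: (z i ord0) => a b; rewrite lecE /= mulrN mulrN opprK mulrC addNr eqxx addr_ge0 // -expr2 sqr_ge0.
apply/matrixP => i j; rewrite ord1 mxE.
have := h i (mem_index_enum _); rewrite mulf_eq0 conjc_eq0 orbb.
by move=> /eqP.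
Qed.

Lemma sqnormE : ctr z *m z = (\tr (z *m ctr z))%:M.
Proof. by rewrite mxtrace_mulC [LHS]mx11_scalar trace_mx11. Qed.

Lemma line_id : line z *m line z = line z.
Proof.
rewrite /line -scalemxAl -scalemxAr mulmxA -(mulmxA z) sqnormE mul_mx_scalar.
by rewrite -scalemxAl (scalerA _ (\tr _)) mulVf ?norm_neq0 // scale1r.
Qed.

Lemma line_ctr : ctr (line z) = line z.
Proof.
rewrite /line ctrZ ctrM ctrK; congr (_ *: _).
by rewrite fmorphV /= -tr_ctr ctrM ctrK.
Qed.

Lemma line_tr : \tr (line z) = 1.
Proof. by rewrite /line mxtraceZ mulVf ?norm_neq0. Qed.

Lemma lineK : line z *m z = z.
Proof.
rewrite /line -scalemxAl -mulmxA sqnormE mul_mx_scalar scalerA.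
by rewrite mulVf ?norm_neq0 // scale1r.
Qed.

End Line.

Lemma cmx_dotC n (A B : 'M[C]_n) : cmx_dot A B = cmx_dot B A.
Proof. exact: (edotC (e := cmx_euclid n)). Qed.

Lemma cmx_dotDl n (A B D : 'M[C]_n) :
  cmx_dot (A + B) D = cmx_dot A D + cmx_dot B D.
Proof. exact: (edotDl (e := cmx_euclid n)). Qed.

Lemma cmx_dotZl n a (A B : 'M[C]_n) : cmx_dot (a%:C *: A) B = a * cmx_dot A B.
Proof. exact: (edotZl (e := cmx_euclid n) a A). Qed.

Lemma cmx_dotDr n (A B D : 'M[C]_n) :
  cmx_dot A (B + D) = cmx_dot A B + cmx_dot A D.
Proof. by rewrite !(cmx_dotC A) cmx_dotDl. Qed.

Lemma cmx_dotM n (P Q A B : 'M[C]_n) :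
  cmx_dot (P *m A *m Q) B = cmx_dot A (ctr P *m B *m ctr Q).
Proof. by rewrite /cmx_dot !ctrM !ctrK -!mulmxA mxtrace_mulC !mulmxA. Qed.

Lemma cmx_dot_ctr n (A B : 'M[C]_n) : cmx_dot (ctr A) B = cmx_dot A (ctr B).
Proof.
rewrite /cmx_dot ctrK -[in LHS](ctrK B) ctrK -ctrM tr_ctr mxtrace_mulC.
by case: (\tr _).
Qed.

Lemma herm_id n (A : 'M[C]_n) : ctr A = A -> herm A = A.
Proof.
move=> hA; have e : A + A = (2 : C) *: A by rewrite scaler_nat.
by rewrite /herm hA e scalerA mulVf ?scale1r // pnatr_eq0.
Qed.

Lemma ctr_herm n (A : 'M[C]_n) : ctr (herm A) = herm A.
Proof. by rewrite /herm ctrZ ctrD ctrK conjc_half addrC. Qed.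

Lemma PC_tprojE n (P A : cmx n) : PC_tproj P A =
  P *m herm A *m (1%:M - P) + (1%:M - P) *m herm A *m P.
Proof. by []. Qed.

Lemma cmx_dot_herm n (A B : 'M[C]_n) : cmx_dot (herm A) B = cmx_dot A (herm B).
Proof.
have e : (2^-1 : C) = (2^-1)%:C by rewrite fmorphV rmorph_nat.
rewrite /herm e cmx_dotZl (cmx_dotC A) cmx_dotZl (cmx_dotC _ A).
by rewrite cmx_dotDl cmx_dotDr cmx_dot_ctr.
Qed.

Section Projector.
Variables (n : nat) (P : cmx n).
Hypotheses (Pid : P *m P = P) (Pctr : ctr P = P).

Lemma ctr_compl : ctr (1%:M - P) = 1%:M - P.
Proof. by rewrite ctrB ctr1 Pctr. Qed.

Lemma compl_l : (1%:M - P) *m P = 0.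
Proof. by rewrite mulmxBl mul1mx Pid subrr. Qed.

Lemma compl_r : P *m (1%:M - P) = 0.
Proof. by rewrite mulmxBr mulmx1 Pid subrr. Qed.

Lemma compl_id : (1%:M - P) *m (1%:M - P) = 1%:M - P.
Proof. by rewrite mulmxBr mulmx1 compl_l subr0. Qed.

Lemma ctr_PC_tproj A : ctr (PC_tproj P A) = PC_tproj P A.
Proof.
by rewrite PC_tprojE ctrD !ctrM ctr_herm ctr_compl Pctr addrC !mulmxA.
Qed.

Lemma PC_tproj_idem A : PC_tproj P (PC_tproj P A) = PC_tproj P A.
Proof.
rewrite [LHS]PC_tprojE (herm_id (ctr_PC_tproj A)) PC_tprojE.
move: (herm A) (compl_l) (compl_r) (compl_id); move: (1%:M - P) => Q H QP PQ QQ.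
rewrite !mulmxDr !mulmxDl !mulmxA PQ QP QQ Pid !mul0mx add0r addr0.
by rewrite -!mulmxA QQ Pid.
Qed.

Lemma PC_tproj_sym A B :
  cmx_dot (PC_tproj P A) B = cmx_dot A (PC_tproj P B).
Proof.
have h X Y : cmx_dot (P *m X *m (1%:M - P) + (1%:M - P) *m X *m P) Y =
    cmx_dot X (P *m Y *m (1%:M - P) + (1%:M - P) *m Y *m P).
  by rewrite cmx_dotDl cmx_dotDr !cmx_dotM ctr_compl Pctr.
have hh X : herm (PC_tproj P X) = PC_tproj P X.
  by rewrite herm_id // ctr_PC_tproj.
rewrite -[in RHS]hh -cmx_dot_herm [PC_tproj P B]PC_tprojE.
rewrite -h -PC_tprojE -[in RHS]cmx_dot_herm hh //.
Qed.

Section Tangent.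
Variable A : cmx n.
Hypothesis tA : PC_tproj P A = A.

Lemma tangent_ctr : ctr A = A.
Proof. by rewrite -tA ctr_PC_tproj. Qed.

Lemma tangent_compress : P *m A *m P = 0.
Proof.
rewrite -tA PC_tprojE mulmxDr mulmxDl !mulmxA compl_r !mul0mx addr0.
by rewrite -!mulmxA compl_l !mulmx0.
Qed.

Lemma tangent_split : A *m P + P *m A = A.
Proof.
rewrite -[RHS]tA PC_tprojE (herm_id tangent_ctr).
by rewrite mulmxBr mulmx1 !mulmxBl mul1mx tangent_compress !subr0 addrC.
Qed.

Lemma tangent_tr : \tr A = 0.
Proof.
have e : \tr (P *m A) = 0.
  by rewrite -Pid -mulmxA mxtrace_mulC tangent_compress mxtrace0.
by rewrite -tangent_split mxtraceD mxtrace_mulC e addr0.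
Qed.

Hypothesis Ptr : \tr P = 1.

Lemma PC_curveE s : PC_curve P A s =
  (1 + s ^+ 2 * complex.Re (\tr (A *m P *m A)))^-1%:C *:
    (P + s%:C *: (A : 'M[C]_n) + (s ^+ 2)%:C *: (A *m P *m A)).
Proof.
have e : (1%:M + s%:C *: (A : 'M[C]_n)) *m P *m
    ctr (1%:M + s%:C *: (A : 'M[C]_n)) =
    P + s%:C *: (A : 'M[C]_n) + (s ^+ 2)%:C *: (A *m P *m A).
  rewrite ctrD ctr1 ctrZ tangent_ctr conjc_real mulmxDl mul1mx mulmxDr mulmx1.
  rewrite mulmxDl -!scalemxAr -!scalemxAl scalerA -rmorphM -expr2.
  by rewrite !addrA -(addrA P) -scalerDr tangent_split.
rewrite /PC_curve e !mxtraceD !mxtraceZ Ptr tangent_tr mulr0 addr0.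
rewrite (tr_real (A := A *m P *m A)); last first.
  by rewrite !ctrM tangent_ctr Pctr mulmxA.
by rewrite -rmorphM -(rmorph1 (real_complex R)) -rmorphD -fmorphV.
Qed.

Lemma PC_curve_velocity :
  ederivable (E := cmx_euclid n) (PC_curve P A) 0 /\
  ederiv (E := cmx_euclid n) (PC_curve P A) 0 = A.
Proof.
apply: curve_velocity_coord => i /=.
under eq_fun do rewrite PC_curveE cmx_dotZl !cmx_dotDl !cmx_dotZl.
set d := complex.Re _; set a := cmx_dot P _; set b := cmx_dot A _.
set c := cmx_dot _ _.
apply: rational_velocity.
Qed.

End Tangent.
End Projector.

(* P(C^n), that is CP^(n-1)(4): a line of C^n is represented by the orthogonal
   projector onto it, as a point of the space of complex matrices. *)
Program Definition PC (n : nat) : manifold R :=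
  @Manifold R (cmx_euclid n) (@PC_points n) (n.-1).*2 (@PC_tproj n)
    (@PC_curve n) _ _ _ _ _.
Next Obligation.
move=> n P A [z z0 ->]; apply: PC_tproj_idem; [exact: line_id|exact: line_ctr].
Qed.
Next Obligation.
move=> n P A B [z z0 ->]; apply: PC_tproj_sym; exact: line_ctr.
Qed.
Next Obligation.
move=> n P A [z z0 ->]; rewrite /PC_curve scale0r addr0 ctr1 mul1mx mulmx1.
by rewrite line_tr // invr1 scale1r.
Qed.
Next Obligation.
move=> n P A [z z0 ->] tA; near=> s.
have PP := line_id z0; have Pc := line_ctr z; rewrite /PC_curve.
set U : 'M[C]_n := 1%:M + _.
exists (U *m z).
  have zN0 := z0; apply: contra_neq z0 => Uz0.
  have : line z *m (U *m z) = z.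
    rewrite mulmxDl mul1mx mulmxDr (lineK zN0) -scalemxAl -scalemxAr.
    rewrite -[in A *m z](lineK zN0) !mulmxA (tangent_compress PP tA).
    by rewrite mul0mx scaler0 addr0.
  by rewrite Uz0 mulmx0 => <-.
have e : U *m line z *m ctr U =
    (\tr (z *m ctr z))^-1 *: (U *m z *m ctr (U *m z)).
  by rewrite /line -scalemxAr -scalemxAl ctrM !mulmxA.
rewrite e /line mxtraceZ invfM invrK scalerA mulrAC mulfV ?norm_neq0 //.
by rewrite mul1r.
Unshelve. all: by end_near. Qed.
Next Obligation.
move=> n P A [z z0 ->] tA; apply: PC_curve_velocity => //.
- exact: line_id.
- exact: line_ctr.
- exact: line_tr.
Qed.

Section Horizontal.
Variables (n : nat) (z : 'cV[C]_n).
Hypothesis z1 : ctr z *m z = 1%:M.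

Let hor (w : 'cV[C]_n) : cmx n := w *m ctr z + z *m ctr w.

Lemma line_unit : line z = z *m ctr z.
Proof. by rewrite /line mxtrace_mulC z1 mxtrace1 invr1 scale1r. Qed.

Lemma line_unit_id : line z *m line z = line z.
Proof. by rewrite line_unit mulmxA -(mulmxA z) z1 mulmx1. Qed.

Lemma ctr_hor w : ctr (hor w) = hor w.
Proof. by rewrite /hor ctrD !ctrM !ctrK addrC. Qed.

(* With [z] on the unit sphere, [w |-> w z* + z w*] is the differential of the
   Hopf map at [z], restricted to the horizontal vectors. *)
Lemma PC_tproj_horizontal (X : cmx n) : PC_tproj (line z) X = X <->
  exists2 w, ctr z *m w = 0 & X = hor w.
Proof.
have Pc := line_ctr z; have PP := line_unit_id.
split=> [tX|[w zw ->]].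
  exists (X *m z).
    have := tangent_compress PP tX; rewrite line_unit => e.
    rewrite -[LHS]mulmx1 -[LHS]mul1mx -z1.
    have -> : ctr z *m z *m (ctr z *m (X *m z) *m (ctr z *m z)) =
        ctr z *m (z *m ctr z *m X *m (z *m ctr z)) *m z by rewrite !mulmxA.
    by rewrite e mulmx0 mul0mx.
  rewrite /hor ctrM (tangent_ctr Pc tX) -[LHS](tangent_split PP Pc tX).
  by rewrite line_unit !mulmxA.
have wz : ctr w *m z = 0 by rewrite -[LHS]ctrK ctrM ctrK zw /ctr map_mx0 trmx0.
rewrite PC_tprojE (herm_id (ctr_hor w)) line_unit /hor.
rewrite !(mulmxBr, mulmxBl, mulmxDr, mulmxDl, mulmxN, mulNmx) !mulmx1 !mul1mx !mulmxA.
rewrite -!(mulmxA _ (ctr z) z) -!(mulmxA _ (ctr z) w) -!(mulmxA _ (ctr w) z).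
rewrite z1 zw wz !(mulmx1, mulmx0, mul0mx).
by rewrite !(addr0, subr0, add0r, subrr, oppr0) addrC.
Qed.

Lemma cmx_dot_horizontal v w : ctr z *m v = 0 -> ctr z *m w = 0 ->
  cmx_dot (hor v) (hor w) = complex.Re (\tr (ctr w *m v)).
Proof.
move=> zv zw; rewrite /cmx_dot ctr_hor.
have vz : ctr v *m z = 0 by rewrite -[LHS]ctrK ctrM ctrK zv /ctr map_mx0 trmx0.
rewrite /hor mulmxDl !mulmxDr !mulmxA.
rewrite -!(mulmxA _ (ctr z) z) -!(mulmxA _ (ctr z) w) -!(mulmxA _ (ctr v) z).
rewrite z1 zw vz !(mulmx1, mulmx0, mul0mx) add0r addr0.
rewrite mxtraceD mxtrace_mulC -!mulmxA (mxtrace_mulC z) -!mulmxA z1 mulmx1.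
have -> : ctr v *m w = ctr (ctr w *m v) by rewrite ctrM ctrK.
rewrite tr_ctr; case: (\tr _) => x y /=.
by rewrite -mulr2n -(mulr_natl x) mulrA mulVf ?mul1r ?pnatr_eq0.
Qed.

Lemma PC_J_horizontal w : ctr z *m w = 0 ->
  PC_J (line z) (hor w) = hor ('i%C *: w).
Proof.
move=> zw; rewrite /PC_J line_unit /hor.
have wz : ctr w *m z = 0 by rewrite -[LHS]ctrK ctrM ctrK zw /ctr map_mx0 trmx0.
rewrite mulmxDl mulmxDr !mulmxA.
rewrite -!(mulmxA _ (ctr z) z) -!(mulmxA _ (ctr z) w) -!(mulmxA _ (ctr w) z).
rewrite z1 zw wz !(mulmx1, mulmx0, mul0mx) addr0 add0r.
rewrite scalerBr ctrZ -scalemxAl -scalemxAr -scaleNr. congr (_ + _).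
suff -> : conjc 'i%C = - 'i%C :> C by [].
by apply/eqP; rewrite eq_complex /= oppr0 !eqxx.
Qed.

End Horizontal.

Definition segre m n (p : cmx m * cmx n) : cmx (m * n) := tensmx p.1 p.2.

Lemma mxtrace_tens m n (A : 'M[C]_m) (B : 'M[C]_n) :
  \tr (tensmx A B) = \tr A * \tr B.
Proof.
by rewrite /mxtrace mulr_sum; apply: eq_bigr => i _; rewrite mxE.
Qed.

(* In homogeneous coordinates, [segre] maps ([z_i], [w_j]) to [z_i w_j]. *)
Lemma segre_line m n (z : 'cV[C]_m) (w : 'cV[C]_n) :
  segre (line z, line w) = line (tensmx z w : 'cV[C]_(m * n)).
Proof.
have e : (tensmx z w : 'cV_(m * n)) *m ctr (tensmx z w : 'cV_(m * n)) =
    tensmx (z *m ctr z) (w *m ctr w).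
  apply/matrixP => i j; rewrite !mxE !big_ord_recl !big_ord0 !addr0 !mxE.
  by rewrite !ord1 rmorphM mulrACA.
rewrite /segre /line e mxtrace_tens invfM /=.
by apply/matrixP => i j; rewrite !mxE mulrACA.
Qed.

End ProjectiveSpace.

Section CurvesInManifolds.
Variables (R : realType) (N : manifold R) (I : set R).

Definition unit_speed_curve (gamma : R -> ambient N) : Prop :=
  smooth_on I gamma /\
  forall t, I t -> points N (gamma t) /\ enorm (ederiv gamma t) = 1.

(* [nu] is the unit normal of the Frenet frame of a unit speed curve in a
   surface [N], and [kappa] the curvature.  The smoothness of [nu] excludes
   jumps between the two opposite unit normals; [kappa] may be negative. *)
Definition frenet (gamma : R -> ambient N) (nu : R -> ambient N) (kappa : R -> R) :
    Prop :=
  smooth_on I nu /\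
  forall t, I t ->
    [/\ tproj (gamma t) (nu t) = nu t,
        enorm (nu t) = 1,
        edot (nu t) (ederiv gamma t) = 0 &
        tproj (gamma t) (ederiv (ederiv gamma) t) = kappa t *: nu t].

End CurvesInManifolds.

(* Main.v *)
Require Import Defs.
From HB Require Import structures.
From mathcomp Require Import all_boot all_order all_algebra.
From mathcomp Require Import all_classical all_reals all_analysis.
From mathcomp Require Import ring.
Import Order.TTheory GRing.Theory Num.Theory.
Import numFieldNormedType.Exports.
Local Open Scope classical_set_scope.
Local Open Scope ring_scope.

Set Implicit Arguments.
Unset Strict Implicit.
Unset Printing Implicit Defensive.

(** Points of a projective space are projectors [S] of rank one and trace one,
and the tangent vectors at [S] are the Hermitian matrices [X = X S + S X]. In
these coordinates the orthogonal projection onto the tangent space is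
[B |-> S B (1 - S) + (1 - S) B S], so covariant derivatives are projected
matrix derivatives, and the curvature tensor is the double commutator
[R(X, Y) Z = [[X, Y], Z]] ([curvature_commutator]).

On the projective line the tangent plane is spanned by [T = gamma'] and [nu].
The Frenet equations ([tproj_T'], [tproj_nu']) give the tension field
[kappa nu] of the curve, its second covariant derivative
[(kappa'' - kappa^3) nu - 3 kappa kappa' T], and, because orthonormal tangent
vectors anticommute and square to the identity, the curvature term
[- 4 kappa nu]. Hence the bitension field of the curve is
[(kappa'' - kappa^3 + 4 kappa) nu - 3 kappa kappa' T] ([bitension_gammaI]).

The Segre embedding sends [(S, P)] to the tensor product of [S] and [P]. Both
factors are totally geodesic in it, so the tension field of the product is the
tensor product of [kappa nu] with [P] ([tension_phi]). In a direction [Y]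
tangent to the projective factor, the Hessian of the tension field ([hessian_XP])
and the curvature term ([curvature_XP]) both equal the tension field multiplied
by [- |Y|^2], so they cancel in the bitension field, which is therefore the
tensor product of that of the curve with [P] ([bitension_phi]).

Everything follows from this formula. The tangential part of the bitension
field is its component on [T], that is [- 3 kappa kappa'], which vanishes
exactly when [kappa] is constant, as [kappa] has no zero. The whole field
vanishes exactly when moreover [kappa^2 = 4], both for the curve and for the
product, and neither is harmonic since [kappa nu] has no zero. The mean
curvature vector is a multiple of the tension field, so its norm is constant
when [kappa] is; its normal derivative along [Y] is the nonzero vector built
from [nu] and [Y] ([tangential_mixed], [mixed_eq0]), and the product contains
complex submanifolds, so it is neither PMC nor totally real. *)

(** * Derivatives of curves in Euclidean spaces *)

Section Derivatives.
Variable R : realType.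
Implicit Types E F G : euclid R.

(** Unlike [ederiv], which is total, this asserts that the derivative exists, so
that the rules of calculus combine without side conditions. *)
Definition is_ederiv E (f : R -> E) (t : R) (v : E) : Prop :=
  forall i, is_derive t (1 : R) (fun s => edot (f s) (ebasis i))
    (edot v (ebasis i)).

Lemma is_ederiv_val E (f : R -> E) t v : is_ederiv f t v -> ederiv f t = v.
Proof.
move=> fv; apply: edot_ext => i; rewrite edot_ederiv derive1E.
exact: (@derive_val _ _ _ _ _ _ _ (fv i)).
Qed.

Lemma ederivable_is_ederiv E (f : R -> E) t :
  ederivable f t -> is_ederiv f t (ederiv f t).
Proof.
move=> df i; rewrite edot_ederiv; apply: DeriveDef; first exact: df.
by rewrite derive1E.
Qed.

Lemma is_ederiv_unique E (f : R -> E) t v w :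
  is_ederiv f t v -> is_ederiv f t w -> v = w.
Proof. by move=> /is_ederiv_val <- /is_ederiv_val. Qed.

Lemma is_ederiv_eq E (f : R -> E) t v w :
  is_ederiv f t v -> v = w -> is_ederiv f t w.
Proof. by move=> ? <-. Qed.

Lemma is_ederiv_near E (f g : R -> E) t v :
  (\forall s \near t, f s = g s) -> is_ederiv f t v -> is_ederiv g t v.
Proof.
move=> fg fv i; apply: near_eq_is_derive (fv i).
by near=> s; congr edot; near: s.
Unshelve. all: by end_near. Qed.

Lemma is_ederiv_cst E (c : E) t : is_ederiv (fun=> c) t 0.
Proof. by move=> i; rewrite edot0; exact: is_derive_cst. Qed.

Lemma is_ederivD E (f g : R -> E) t v w :
  is_ederiv f t v -> is_ederiv g t w ->
  is_ederiv (fun s => f s + g s) t (v + w).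
Proof.
move=> fv gw i; rewrite edotDl; under eq_fun do rewrite edotDl.
exact: (is_deriveD (fv i) (gw i)).
Qed.

Lemma is_derive_bigsum (I : finType) (h : I -> R -> R) (dh : I -> R) (t : R) :
  (forall i, is_derive t (1 : R) (h i) (dh i)) ->
  is_derive t (1 : R) (fun s => \sum_i h i s) (\sum_i dh i).
Proof.
move=> d; rewrite -[index_enum _]/(index_enum I).
elim: (index_enum I) => [|i r IH].
  rewrite big_nil; under eq_fun do rewrite big_nil; exact: is_derive_cst.
rewrite big_cons; under eq_fun do rewrite big_cons.
exact: (is_deriveD (d i) IH).
Qed.

Definition real_linear E F (L : E -> F) : Prop :=
  (forall u v, L (u + v) = L u + L v) /\ (forall a u, L (a *: u) = a *: L u).

Lemma real_linear_sum E F (L : E -> F) (I : finType) (f : I -> E) :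
  real_linear L -> L (\sum_i f i) = \sum_i L (f i).
Proof.
move=> [LD LZ]; apply: (big_morph L LD).
by rewrite -(scale0r (0 : E)) LZ scale0r.
Qed.

Lemma real_linear_comb4 E F (L : E -> F) a b c d u v w x : real_linear L ->
  L (a *: u + b *: v + (c *: w + d *: x)) =
  a *: L u + b *: L v + (c *: L w + d *: L x).
Proof. by move=> [LD LZ]; rewrite !LD !LZ. Qed.

Lemma edot_sum E (u v : E) :
  edot u v = \sum_i edot u (ebasis i) * edot v (ebasis i).
Proof.
rewrite [in LHS](ebasis_expansion u) edot_suml; apply: eq_bigr => i _.
by rewrite edotZl (edotC _ v).
Qed.

Lemma edot_ge0 E (v : E) : 0 <= edot v v.
Proof. by rewrite edot_sum; apply: sumr_ge0 => i _; rewrite -expr2 sqr_ge0. Qed.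

Lemma edot_eq0 E (v : E) : edot v v = 0 -> v = 0.
Proof.
rewrite edot_sum => /eqP; rewrite psumr_eq0 => [/allP h|i _]; last first.
  by rewrite -expr2 sqr_ge0.
apply: edot_ext => i; rewrite edot0; apply/eqP.
by have := h i (mem_index_enum _); rewrite -expr2 sqrf_eq0.
Qed.

Lemma edotBl E (u v w : E) : edot (u - v) w = edot u w - edot v w.
Proof. by rewrite edotDl -scaleN1r edotZl mulN1r. Qed.

Lemma edotDr E (u v w : E) : edot u (v + w) = edot u v + edot u w.
Proof. by rewrite !(edotC u) edotDl. Qed.

Lemma edotZr E a (u v : E) : edot u (a *: v) = a * edot u v.
Proof. by rewrite !(edotC u) edotZl. Qed.

Lemma edotBr E (u v w : E) : edot u (v - w) = edot u v - edot u w.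
Proof. by rewrite !(edotC u) edotBl. Qed.

(** The product rule holds for every real bilinear operation, since its
coordinates are fixed bilinear forms in the coordinates of the two factors.
It is applied to products and tensor products of matrices, to scalings and to
inner products. *)
Lemma is_ederiv_bilinear E F G (b : E -> F -> G)
    (bl : forall v, real_linear (b^~ v)) (br : forall u, real_linear (b u))
    (f : R -> E) (g : R -> F) t u v :
  is_ederiv f t u -> is_ederiv g t v ->
  is_ederiv (fun s => b (f s) (g s)) t (b u (g t) + b (f t) v).
Proof.
move=> fu gv k.
have e x y : edot (b x y) (ebasis k) = \sum_i \sum_j
    edot x (ebasis i) * edot y (ebasis j) *
    edot (b (ebasis i) (ebasis j)) (ebasis k).
  rewrite [in LHS](ebasis_expansion x) (real_linear_sum _ (bl y) : b _ y = _).
  rewrite edot_suml; apply: eq_bigr => i _; rewrite (bl y).2 edotZl.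
  rewrite [in LHS](ebasis_expansion y) (real_linear_sum _ (br _) : b _ _ = _).
  rewrite edot_suml mulr_sumr.
  by apply: eq_bigr => j _; rewrite (br _).2 edotZl mulrA.
under eq_fun do rewrite e.
rewrite edotDl !e -big_split; apply: is_derive_bigsum => i /=.
rewrite -big_split; apply: is_derive_bigsum => j /=.
have := is_deriveM (is_deriveM (fu i) (gv j))
  (is_derive_cst (edot (b (ebasis i) (ebasis j)) (ebasis k)) t (1 : R)).
move=> /is_derive_eq; apply; rewrite /GRing.scale /=.
ring.
Qed.

Lemma is_ederiv_linear E F (L : E -> F) (f : R -> E) t v :
  real_linear L -> is_ederiv f t v -> is_ederiv (fun s => L (f s)) t (L v).
Proof.
move=> hL fv k.
have e x : edot (L x) (ebasis k) =
    \sum_i edot x (ebasis i) * edot (L (ebasis i)) (ebasis k).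
  rewrite [in LHS](ebasis_expansion x) real_linear_sum // edot_suml.
  by apply: eq_bigr => i _; rewrite hL.2 edotZl.
under eq_fun do rewrite e.
rewrite e; apply: is_derive_bigsum => i.
have := is_deriveM (fv i) (is_derive_cst (edot (L (ebasis i)) (ebasis k)) t (1 : R)).
move=> /is_derive_eq; apply; rewrite /GRing.scale /=; ring.
Qed.

Lemma is_ederivB E (f g : R -> E) t v w :
  is_ederiv f t v -> is_ederiv g t w ->
  is_ederiv (fun s => f s - g s) t (v - w).
Proof.
move=> fv gw; apply: is_ederivD => //.
apply: (@is_ederiv_linear E E -%R) => //.
by split=> [u u'|a u]; rewrite ?opprD ?scalerN.
Qed.

Lemma is_ederivZ E (a : R -> R) (f : R -> E) t a' v :
  is_derive t (1 : R) a a' -> is_ederiv f t v ->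
  is_ederiv (fun s => a s *: f s) t (a' *: f t + a t *: v).
Proof.
move=> da df.
apply: (@is_ederiv_bilinear (real_line R) E E (fun c u => c *: u)) => //.
- by move=> u; split=> [x y|x y] /=; rewrite ?scalerDl // scalerA.
- by move=> x; split=> [u w|c u] /=; rewrite ?scalerDr // !scalerA mulrC.
- by move=> [] /=; rewrite mulr1; under eq_fun do rewrite mulr1.
Qed.

Lemma is_derive_edot E (f g : R -> E) t v w :
  is_ederiv f t v -> is_ederiv g t w ->
  is_derive t (1 : R) (fun s => edot (f s) (g s)) (edot v (g t) + edot (f t) w).
Proof.
move=> df dg.
have := @is_ederiv_bilinear E E (real_line R) (fun u u' => edot u u') _ _ _ _ _ _ _ df dg.
move=> /(_ _ _ tt) /=; rewrite mulr1; under eq_fun do rewrite mulr1.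
apply.
- by move=> u; split=> [x y|a x] /=; rewrite ?edotDl ?edotZl.
- by move=> u; split=> [x y|a x] /=; rewrite !(edotC u) ?edotDl ?edotZl.
Qed.

Lemma is_derive_affine (f : R -> R) (t x : R) v :
  is_derive t (1 : R) f v -> is_derive (0 : R) (1 : R) (fun s => f (t + s * x)) (x * v).
Proof.
move=> fv.
have h : is_derive (0 : R) (1 : R) (fun s : R => t + s * x) x.
  by apply: is_derive_eq; rewrite add0r mul1r scaler0 add0r /GRing.scale /= mulr1.
have fv' : is_derive (t + 0 * x) (1 : R) f v by rewrite mul0r addr0.
rewrite mulrC.
exact: (@is_derive1_comp _ f (fun s => t + s * x) 0 v x fv' h).
Qed.

Lemma is_ederiv_affine E (f : R -> E) t x v :
  is_ederiv f t v -> is_ederiv (fun s => f (t + s * x)) 0 (x *: v).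
Proof.
move=> fv i; rewrite edotZl.
exact: (is_derive_affine (f := fun s => edot (f s) (ebasis i))).
Qed.

Lemma is_ederiv_pair E F (f : R -> E) (g : R -> F) t v w :
  is_ederiv f t v -> is_ederiv g t w ->
  is_ederiv (E := euclid_prod E F) (fun s => (f s, g s)) t (v, w).
Proof.
move=> fv gw [] i /=; rewrite ?edot0r.
  by rewrite addr0; under eq_fun do rewrite edot0r addr0.
by rewrite add0r; under eq_fun do rewrite edot0r add0r.
Qed.

(** ** Fields along a submanifold *)

Lemma is_ederiv_curve (M : manifold R) (p x : ambient M) :
  points M p -> tproj p x = x -> is_ederiv (curve p x) 0 x.
Proof.
move=> Mp tx; have [d e] := curve_velocity Mp tx.
by rewrite -[X in is_ederiv _ _ X]e; apply: ederivable_is_ederiv.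
Qed.

(** A tangential derivative depends only on the values on the submanifold,
because the curve it is computed along stays on the submanifold. *)
Lemma dirder_eq (M : manifold R) E (V W : ambient M -> E) (p x : ambient M) v :
  points M p -> tproj p x = x -> (forall q, points M q -> V q = W q) ->
  is_ederiv (fun s => W (curve p x s)) 0 v -> dirder V p x = v.
Proof.
move=> Mp tx VW Wv; apply: is_ederiv_val; apply: is_ederiv_near Wv.
by near=> s; rewrite VW //; near: s; exact: curve_in.
Unshelve. all: by end_near. Qed.

End Derivatives.

(** * Projectors and their tangent vectors *)

Section ProjectorAlgebra.
Variable F : comNzRingType.
Variable n : nat.
Implicit Types A B S X Y : 'M[F]_n.

Let expand := (@mulmxDl F, @mulmxDr F, @mulmxBl F, @mulmxBr F,
  @mulmxN F, @mulNmx F, @mul1mx F, @mulmx1 F, @mulmxA F).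

(* Proves an equality between linear combinations of noncommutative monomials:
   each monomial becomes an indeterminate matrix, and the entries are compared. *)
Ltac mx_linear :=
  repeat match goal with |- context [@mulmx ?r ?m ?n ?p ?A ?B] =>
    let x := fresh "m" in set x := (@mulmx r m n p A B); clearbody x end;
  apply/matrixP => ? ?; rewrite !mxE; ring.

Definition anticommutator A B : 'M[F]_n := A *m B + B *m A.

Definition commutator A B : 'M[F]_n := A *m B - B *m A.

(** For Hermitian [B], the orthogonal projection onto the tangent space at the
projector [S]: the part of [B] that exchanges the image and the kernel of [S]. *)
Definition offdiag S B : 'M[F]_n :=
  S *m B *m (1%:M - S) + (1%:M - S) *m B *m S.

(** The derivative of [offdiag S B] with respect to [S] in the direction [X]. *)
Definition doffdiag S B X : 'M[F]_n :=
  X *m B *m (1%:M - S) + (1%:M - S) *m B *m X - X *m B *m S - S *m B *m X.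

Lemma offdiagD S A B : offdiag S (A + B) = offdiag S A + offdiag S B.
Proof. by rewrite /offdiag (mulmxDr S) (mulmxDr (1%:M - S)) !mulmxDl addrACA. Qed.

Lemma offdiagN S A : offdiag S (- A) = - offdiag S A.
Proof. by rewrite /offdiag !mulmxN !mulNmx opprD. Qed.

Lemma offdiagZ S a A : offdiag S (a *: A) = a *: offdiag S A.
Proof. by rewrite /offdiag -!(scalemxAr, scalemxAl) scalerDr. Qed.

Lemma doffdiagB S B X Y : doffdiag S B (X - Y) = doffdiag S B X - doffdiag S B Y.
Proof. rewrite /doffdiag !expand; mx_linear. Qed.

(** The left-hand side is what the product rule yields for [offdiag S B], when
[X] and [D] are the derivatives of [S] and [B]. *)
Lemma doffdiag_productE S B X D :
  (X *m B + S *m D) *m (1%:M - S) + S *m B *m (0 - X) +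
    (((0 - X) *m B + (1%:M - S) *m D) *m S + (1%:M - S) *m B *m X) =
  doffdiag S B X + offdiag S D.
Proof. rewrite sub0r /doffdiag /offdiag !expand; mx_linear. Qed.

(** Likewise for [doffdiag S B Y] with [B] constant, when [X] and [D] are the
derivatives of [S] and [Y]. *)
Lemma doffdiag_productE2 S B X Y D :
  (D *m B + Y *m 0) *m (1%:M - S) + Y *m B *m (0 - X) +
    (((0 - X) *m B + (1%:M - S) *m 0) *m Y + (1%:M - S) *m B *m D) -
    ((D *m B + Y *m 0) *m S + Y *m B *m X) -
    ((X *m B + S *m 0) *m Y + S *m B *m D) =
  doffdiag S B D - (Y *m B *m X + X *m B *m Y) - (Y *m B *m X + X *m B *m Y).
Proof. rewrite sub0r !mulmx0 !addr0 /doffdiag !expand; mx_linear. Qed.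

Section Projector.
Variable S : 'M[F]_n.
Hypothesis SS : S *m S = S.

Let SSr A : A *m S *m S = A *m S.
Proof. by rewrite -mulmxA SS. Qed.

Lemma offdiag_split B : offdiag S B *m S + S *m offdiag S B = offdiag S B.
Proof. rewrite /offdiag !(expand, SS, SSr); mx_linear. Qed.

Section Tangent.
Variable X : 'M[F]_n.
Hypothesis tX : X *m S + S *m X = X.

Let XS : X *m S = X - S *m X.
Proof. by rewrite -[X in X - _]tX addrK. Qed.

Let XSr A : A *m X *m S = A *m X - A *m S *m X.
Proof. by rewrite -mulmxA XS mulmxBr mulmxA. Qed.

Lemma offdiag_id : offdiag S X = X.
Proof. rewrite /offdiag !(expand, SS, SSr, XS, XSr); mx_linear. Qed.

Lemma tangent_compress0 : S *m X *m S = 0.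
Proof. by rewrite XSr SS subrr. Qed.

(** This is [Y = Y S + S Y] along the tangent field [offdiag S B], differentiated
in the direction [X]; the term that is not tangent is symmetric in the field
and the direction, which makes the Lie bracket of tangent fields tangent. *)
Lemma doffdiag_split B :
  doffdiag S B X = doffdiag S B X *m S + S *m doffdiag S B X +
    anticommutator X (offdiag S B).
Proof.
rewrite /anticommutator /doffdiag /offdiag !(expand, SS, SSr, XS, XSr).
mx_linear.
Qed.

Lemma offdiag_doffdiag B : offdiag S (doffdiag S B X) =
  anticommutator X ((1%:M - S) *m B *m (1%:M - S) - S *m B *m S).
Proof.
rewrite /anticommutator /doffdiag /offdiag !(expand, SS, SSr, XS, XSr).
mx_linear.
Qed.

Lemma diag_doffdiag B :
  (1%:M - S) *m doffdiag S B X *m (1%:M - S) - S *m doffdiag S B X *m S =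
  anticommutator X (offdiag S B).
Proof.
rewrite /anticommutator /doffdiag /offdiag !(expand, SS, SSr, XS, XSr).
mx_linear.
Qed.

End Tangent.

(** The algebra behind the curvature of the space of projectors: by
[offdiag_doffdiag], the tangential part of the derivative of [offdiag S D] only
involves the diagonal part of [D], which is given by [diag_doffdiag]. *)
Lemma offdiag_curvature X Y B :
  X *m S + S *m X = X -> Y *m S + S *m Y = Y ->
  offdiag S (doffdiag S (doffdiag S B Y) X - doffdiag S (doffdiag S B X) Y) =
  commutator (commutator X Y) (offdiag S B).
Proof.
move=> tX tY; rewrite offdiagD offdiagN !offdiag_doffdiag // !diag_doffdiag //.
rewrite /anticommutator /commutator !expand; mx_linear.
Qed.

(** Here [D] and [D'] are the derivatives of the field [Y] along [X] and of [X]
along [Y]: the bracket term of the curvature removes them, and the symmetric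
terms [K] cancel. *)
Lemma offdiag_curvature_fields X Y B D D' K :
  X *m S + S *m X = X -> Y *m S + S *m Y = Y ->
  offdiag S (doffdiag S (doffdiag S B Y) X) + offdiag S (doffdiag S B D - K - K) -
    (offdiag S (doffdiag S (doffdiag S B X) Y) + offdiag S (doffdiag S B D' - K - K)) -
    offdiag S (doffdiag S B (D - D')) =
  commutator (commutator X Y) (offdiag S B).
Proof.
move=> tX tY; rewrite -offdiag_curvature // doffdiagB !(offdiagD, offdiagN).
apply/matrixP => i j; rewrite !mxE; ring.
Qed.

End Projector.
End ProjectorAlgebra.

(** * Complex projective space *)

Section ProjectiveGeometry.
Variables (R : realType) (n : nat).
Local Notation C := R[i].
Local Notation P := (PC R n).
Implicit Types A B S X Y : cmx R n.

Lemma cmx_scaleE (a : R) A : a *: A = (a%:C)%C *: (A : 'M[C]_n).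
Proof. by []. Qed.

Lemma is_ederiv_mulmx (f g : R -> cmx R n) t u v :
  is_ederiv (E := cmx_euclid R n) f t u -> is_ederiv (E := cmx_euclid R n) g t v ->
  is_ederiv (E := cmx_euclid R n) (fun s => f s *m g s) t (u *m g t + f t *m v).
Proof.
apply: (@is_ederiv_bilinear R (cmx_euclid R n) (cmx_euclid R n) (cmx_euclid R n)
  (fun A B => A *m B)) => A; split=> [B D|a B] /=.
- exact: mulmxDl.
- by rewrite !cmx_scaleE -scalemxAl.
- exact: mulmxDr.
- by rewrite !cmx_scaleE -scalemxAr.
Qed.

Lemma ctr0 m p : ctr 0 = 0 :> 'M[C]_(m, p).
Proof. by rewrite /ctr map_mx0 trmx0. Qed.

Lemma hermD (A B : 'M[C]_n) : herm (A + B) = herm A + herm B.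
Proof. by rewrite /herm ctrD addrACA scalerDr. Qed.

Lemma hermZ (a : R) (A : 'M[C]_n) :
  herm ((a%:C)%C *: A) = (a%:C)%C *: herm A.
Proof. by rewrite /herm ctrZ conjc_real -scalerDr !scalerA mulrC. Qed.

Lemma herm_linear : real_linear (@herm R n : cmx_euclid R n -> cmx_euclid R n).
Proof. by split=> [A B|a A]; [exact: hermD|exact: hermZ]. Qed.

Lemma is_ederiv_PC_tproj (S B : R -> cmx R n) t S0 B0 X B' :
  S t = S0 -> B t = B0 ->
  is_ederiv (E := cmx_euclid R n) S t X ->
  is_ederiv (E := cmx_euclid R n) B t B' ->
  is_ederiv (E := cmx_euclid R n) (fun s => PC_tproj (S s) (B s)) t
    (doffdiag S0 (herm B0) X + PC_tproj S0 B').
Proof.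
move=> <- <- dS dB.
have dH := is_ederiv_linear herm_linear dB.
have dQ := is_ederivB (is_ederiv_cst (E := cmx_euclid R n) 1%:M t) dS.
have := is_ederivD (is_ederiv_mulmx (is_ederiv_mulmx dS dH) dQ)
  (is_ederiv_mulmx (is_ederiv_mulmx dQ dH) dS).
by move=> /is_ederiv_eq; apply; exact: doffdiag_productE.
Qed.

Lemma is_ederiv_doffdiag (S Y : R -> cmx R n) B t S0 Y0 X D :
  S t = S0 -> Y t = Y0 ->
  is_ederiv (E := cmx_euclid R n) S t X ->
  is_ederiv (E := cmx_euclid R n) Y t D ->
  is_ederiv (E := cmx_euclid R n) (fun s => doffdiag (S s) B (Y s)) t
    (doffdiag S0 B D - (Y0 *m B *m X + X *m B *m Y0)
       - (Y0 *m B *m X + X *m B *m Y0)).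
Proof.
move=> <- <- dS dY.
have dB := is_ederiv_cst (E := cmx_euclid R n) B t.
have dQ := is_ederivB (is_ederiv_cst (E := cmx_euclid R n) 1%:M t) dS.
have := is_ederivB (is_ederivB (is_ederivD
    (is_ederiv_mulmx (is_ederiv_mulmx dY dB) dQ)
    (is_ederiv_mulmx (is_ederiv_mulmx dQ dB) dY))
    (is_ederiv_mulmx (is_ederiv_mulmx dY dB) dS))
  (is_ederiv_mulmx (is_ederiv_mulmx dS dB) dY).
by move=> /is_ederiv_eq; apply; exact: doffdiag_productE2.
Qed.

Lemma ctr_doffdiag (S B X : 'M[C]_n) :
  ctr S = S -> ctr B = B -> ctr X = X -> ctr (doffdiag S B X) = doffdiag S B X.
Proof.
move=> hS hB hX; rewrite /doffdiag !(ctrB, ctrD, ctrM, ctr1) hS hB hX !mulmxA.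
by rewrite addrAC (addrC (X *m B *m _)).
Qed.

Lemma tproj_herm (S B : cmx R n) : ctr B = B -> PC_tproj S B = offdiag S B.
Proof. by move=> hB; rewrite /PC_tproj herm_id. Qed.

Lemma tproj0 (S : cmx R n) : PC_tproj S 0 = 0.
Proof. by rewrite tproj_herm ?ctr0 // /offdiag mulmx0 !(mul0mx, mulmx0) addr0. Qed.

Lemma tproj_linear (S : cmx R n) :
  real_linear (PC_tproj S : cmx_euclid R n -> cmx_euclid R n).
Proof.
split=> [A B|a A].
  exact: (etrans (congr1 (offdiag S) (hermD A B)) (offdiagD S _ _)).
exact: (etrans (congr1 (offdiag S) (hermZ a A)) (offdiagZ S _ _)).
Qed.

Section Point.
Variable S : cmx R n.
Hypothesis PS : points P S.

Lemma point_id : S *m S = S.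
Proof. by have [z z0 ->] := PS; exact: line_id. Qed.

Lemma point_ctr : ctr S = S.
Proof. by have [z z0 ->] := PS; exact: line_ctr. Qed.

Lemma point_tr : \tr S = 1.
Proof. by have [z z0 ->] := PS; exact: line_tr. Qed.

(** A point has rank one, so its two sides leave only a scalar of [A]. *)
Lemma point_compress (A : 'M[C]_n) : S *m A *m S = \tr (S *m A) *: S.
Proof.
have [z z0 ->] := PS; rewrite /line.
set c := (_)^-1; rewrite -!(scalemxAl, scalemxAr) mxtraceZ.
have -> : z *m ctr z *m A *m (z *m ctr z) = z *m (ctr z *m A *m z) *m ctr z.
  by rewrite !mulmxA.
rewrite [ctr z *m A *m z]mx11_scalar -trace_mx11 mul_mx_scalar -!scalemxAl.
by rewrite !scalerA mxtrace_mulC mulmxA mulrAC.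
Qed.

Lemma tangentP (X : cmx R n) :
  PC_tproj S X = X <-> ctr X = X /\ X *m S + S *m X = X.
Proof.
split=> [tX|[hX tX]].
  split; first exact: (tangent_ctr point_ctr tX).
  exact: (tangent_split point_id point_ctr tX).
rewrite /PC_tproj herm_id //; exact: (offdiag_id point_id tX).
Qed.

Lemma tangent_tproj (A : cmx R n) : PC_tproj S (PC_tproj S A) = PC_tproj S A.
Proof. exact: (PC_tproj_idem point_id point_ctr A). Qed.

Lemma ctr_tproj (A : cmx R n) : ctr (PC_tproj S A) = PC_tproj S A.
Proof. exact: (ctr_PC_tproj point_ctr A). Qed.

Lemma PC_curve0 (X : cmx R n) : PC_curve S X 0 = S.
Proof. exact: (curve0 (m := P) X PS). Qed.

(** The flat derivative of the tangent field that extends [y]; its tangential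
part is the covariant derivative. *)
Lemma is_ederiv_tfield (X y : cmx R n) : PC_tproj S X = X ->
  is_ederiv (E := cmx_euclid R n) (fun s => PC_tproj (PC_curve S X s) y) 0
    (doffdiag S (herm y) X).
Proof.
move=> tX.
have := is_ederiv_PC_tproj (PC_curve0 X) erefl (is_ederiv_curve PS tX)
  (is_ederiv_cst (E := cmx_euclid R n) y 0).
by move=> /is_ederiv_eq; apply; rewrite tproj0 addr0.
Qed.

End Point.

End ProjectiveGeometry.

(** ** Orthonormal frames and curvature *)

Section OrthonormalFrame.
Variables (R : realType) (N : manifold R) (p T nu : ambient N).
Hypothesis Np : points N p.

(** The squared norms of the projections of the basis vectors add up to the
dimension of the tangent space; so in dimension 2 the component orthogonal to
two orthonormal tangent vectors has total squared norm [2 - 1 - 1]. *)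
Lemma tproj_frame (v : ambient N) :
  \sum_i edot (tproj p (ebasis i)) (tproj p (ebasis i)) = 2 ->
  tproj p T = T -> tproj p nu = nu ->
  edot T T = 1 -> edot nu nu = 1 -> edot nu T = 0 ->
  tproj p v = edot v T *: T + edot v nu *: nu.
Proof.
move=> dim tT tnu TT nn nT.
(* the component of the projection of [u] orthogonal to both vectors *)
pose r u := tproj p u - (edot u T *: T + edot u nu *: nu).
have rr u : edot (r u) (r u) =
    edot (tproj p u) (tproj p u) - edot u T * edot u T - edot u nu * edot u nu.
  have uT : edot (tproj p u) T = edot u T by rewrite tproj_sym // tT.
  have un : edot (tproj p u) nu = edot u nu by rewrite tproj_sym // tnu.
  have Tn : edot T nu = 0 by rewrite edotC.
  rewrite /r !(edotBl, edotBr) !(edotDl, edotDr, edotZl, edotZr).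
  by rewrite (edotC T (tproj p u)) (edotC nu (tproj p u)) uT un TT nn nT Tn; ring.
have r0 i : r (ebasis i) = 0.
  have : \sum_i edot (r (ebasis i)) (r (ebasis i)) = 0.
    under eq_bigr do rewrite rr !(edotC (ebasis _)).
    by rewrite !sumrB dim -!edot_sum TT nn; ring.
  move=> /eqP; rewrite psumr_eq0 => [/allP h|j _]; last exact: edot_ge0.
  by apply: edot_eq0; apply/eqP; exact: h (mem_index_enum i).
apply: edot_ext => i; apply/eqP; rewrite -subr_eq0 -edotBl.
have -> : edot (tproj p v - (edot v T *: T + edot v nu *: nu)) (ebasis i) =
    edot (r (ebasis i)) v.
  rewrite /r !edotBl !(edotDl, edotZl) [in RHS](tproj_sym _ _ Np).
  by rewrite [in RHS]edotC (tproj_sym _ _ Np) !(edotC _ (ebasis i)) !(edotC _ v); ring.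
by rewrite r0 edot0.
Qed.

End OrthonormalFrame.

Section ProjectiveCurvature.
Variables (R : realType) (n : nat).
Local Notation C := R[i].
Local Notation P := (PC R n).

Lemma conn_tfield (S z : cmx R n) (X : cmx R n -> cmx R n) :
  points P S -> PC_tproj S (X S) = X S ->
  conn (M := P) X (tfield (M := P) z) S =
  PC_tproj S (doffdiag S (herm z) (X S)).
Proof.
move=> PS tX; rewrite /conn /pconn /dirder /=; congr PC_tproj.
exact: (is_ederiv_val (is_ederiv_tfield PS z tX)).
Qed.

Lemma hermitianB (A B : 'M[C]_n) :
  ctr A = A -> ctr B = B -> ctr (A - B) = A - B.
Proof. by move=> hA hB; rewrite ctrB hA hB. Qed.

Lemma ctr_second_derivative (S B X Y D : 'M[C]_n) :
  ctr S = S -> ctr B = B -> ctr X = X -> ctr Y = Y -> ctr D = D ->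
  ctr (doffdiag S B D - (Y *m B *m X + X *m B *m Y) -
    (Y *m B *m X + X *m B *m Y)) =
  doffdiag S B D - (Y *m B *m X + X *m B *m Y) - (Y *m B *m X + X *m B *m Y).
Proof.
move=> hS hB hX hY hD; rewrite ctrB (ctrB (doffdiag _ _ _)) (ctr_doffdiag hS hB hD).
suff -> : ctr (Y *m B *m X + X *m B *m Y) = Y *m B *m X + X *m B *m Y by [].
by rewrite ctrD !ctrM hX hY hB !mulmxA addrC.
Qed.

Lemma tproj_tprojD (S A B : cmx R n) : points P S -> ctr A = A -> ctr B = B ->
  PC_tproj S (A + PC_tproj S B) = offdiag S A + offdiag S B.
Proof.
move=> PS hA hB; rewrite (tproj_herm S hB) (tproj_herm S); last first.
  by rewrite ctrD hA -(tproj_herm S hB) (ctr_tproj PS).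
by rewrite offdiagD (offdiag_id (point_id PS) (offdiag_split (point_id PS) B)).
Qed.

(** The terms [K] come from differentiating the projection inside the first
covariant derivative; they are symmetric in [X] and [Y]. *)
Lemma conn_conn_tfield (S x y z : cmx R n) : points P S ->
  let X := PC_tproj S x in let Y := PC_tproj S y in
  let D := doffdiag S (herm y) X in let B := herm z in
  let K := Y *m B *m X + X *m B *m Y in
  conn (M := P) (tfield (M := P) x)
    (conn (M := P) (tfield (M := P) y) (tfield (M := P) z)) S =
  offdiag S (doffdiag S (doffdiag S B Y) X) +
  offdiag S (doffdiag S B D - K - K).
Proof.
move=> PS X Y D B K.
have hS := point_ctr PS; have hB : ctr B = B := ctr_herm z.
have hX : ctr X = X := ctr_tproj PS x; have hY : ctr Y = Y := ctr_tproj PS y.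
have tX : PC_tproj S X = X := tangent_tproj PS x.
have hD : ctr D = D := ctr_doffdiag hS (ctr_herm y) hX.
have hE : ctr (doffdiag S B D - K - K) = doffdiag S B D - K - K.
  exact: ctr_second_derivative.
have hBY : ctr (doffdiag S B Y) = doffdiag S B Y := ctr_doffdiag hS hB hY.
have hBYX := ctr_doffdiag hS hBY hX.
rewrite /conn /pconn /=.
have -> : dirder (M := P) (F := cmx_euclid R n)
    (conn (M := P) (tfield (M := P) y) (tfield (M := P) z)) S X =
    doffdiag S (doffdiag S B Y) X + PC_tproj S (doffdiag S B D - K - K).
  apply: (@dirder_eq R P (cmx_euclid R n) _
    (fun S => PC_tproj S (doffdiag S B (PC_tproj S y))) S X _ PS tX).
    move=> q Pq.
    exact: (@conn_tfield q z (fun q => PC_tproj q y) Pq (tangent_tproj Pq y)).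
  have dS := is_ederiv_curve (M := P) PS tX.
  have dY := is_ederiv_tfield PS y tX.
  have e0 := PC_curve0 PS X.
  have eY := congr1 (fun q => PC_tproj q y) e0.
  have eB := congr1 (fun q => doffdiag q B (PC_tproj q y)) e0.
  have := is_ederiv_PC_tproj e0 eB dS (is_ederiv_doffdiag B e0 eY dS dY).
  rewrite (herm_id hBY); exact.
exact: tproj_tprojD.
Qed.

Lemma bracket_split (S X Y D D' : 'M[C]_n) :
  D = D *m S + S *m D + anticommutator X Y ->
  D' = D' *m S + S *m D' + anticommutator Y X ->
  (D - D') *m S + S *m (D - D') = D - D'.
Proof.
move=> eD eD'; rewrite [in RHS]eD [in RHS]eD' /anticommutator mulmxBl mulmxBr.
by rewrite (addrC (Y *m X)) opprD [RHS]addrACA subrr addr0 opprD [RHS]addrACA.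
Qed.

(** Complex projective space is a symmetric space: on the projectors, regarded
as a submanifold of the Hermitian matrices, its curvature is a double
commutator. *)
Lemma curvature_commutator (S x y z : cmx R n) : points P S ->
  curvature (M := P) S x y z =
  commutator (commutator (PC_tproj S x) (PC_tproj S y)) (PC_tproj S z).
Proof.
move=> PS; have SS := point_id PS; have hS := point_ctr PS.
set X := PC_tproj S x; set Y := PC_tproj S y.
have tX : PC_tproj S X = X := tangent_tproj PS x.
have tY : PC_tproj S Y = Y := tangent_tproj PS y.
have /(tangentP PS)[hX sX] := tX; have /(tangentP PS)[hY sY] := tY.
set D := doffdiag S (herm y) X; set D' := doffdiag S (herm x) Y.
have br : bracket (M := P) (tfield (M := P) x) (tfield (M := P) y) S = D - D'.
  rewrite /bracket /dirder; congr (_ - _).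
    exact: (is_ederiv_val (is_ederiv_tfield PS y tX)).
  exact: (is_ederiv_val (is_ederiv_tfield PS x tY)).
have hD : ctr D = D := ctr_doffdiag hS (ctr_herm y) hX.
have hD' : ctr D' = D' := ctr_doffdiag hS (ctr_herm x) hY.
have hDD := hermitianB hD hD'.
have tDD : PC_tproj S (D - D') = D - D'.
  apply/(tangentP PS); split; first exact: hDD.
  exact: (bracket_split (doffdiag_split SS sX _) (doffdiag_split SS sY _)).
have hDz := ctr_doffdiag hS (ctr_herm z) hDD.
have eXY := conn_conn_tfield x y z PS; have eYX := conn_conn_tfield y x z PS.
rewrite /= -/X -/Y -/D in eXY; rewrite /= -/X -/Y -/D' in eYX.
rewrite (addrC (X *m _ *m Y)) in eYX.
pose V := bracket (M := P) (tfield (M := P) x) (tfield (M := P) y).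
have tV : PC_tproj S (V S) = V S by rewrite [V S]br; exact: tDD.
have eB : conn (M := P) V (tfield (M := P) z) S =
    offdiag S (doffdiag S (herm z) (D - D')).
  rewrite (conn_tfield z PS tV) [V S]br; exact: (tproj_herm S hDz).
pose sub (A A' : cmx R n) := A - A'.
exact: (etrans (congr2 sub (congr2 sub eXY eYX) eB)
  (offdiag_curvature_fields SS (herm z) D D' _ sX sY)).
Qed.

End ProjectiveCurvature.

(** ** Dimension and norm *)

Lemma mulmx_entry_linear (F : comNzRingType) n (A B X Y : 'M[F]_n) h c d k l :
  (A *m (h *: (c *: X + d *: Y)) *m B) k l =
  h * (c * (A *m X *m B) k l + d * (A *m Y *m B) k l).
Proof.
rewrite -scalemxAr -scalemxAl mulmxDr mulmxDl -!scalemxAr -!scalemxAl.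
by set X' := A *m _ *m B; set Y' := A *m _ *m B; rewrite !mxE.
Qed.

Lemma mulmx_delta (F : comNzRingType) n (A B : 'M[F]_n) k l i j :
  (A *m delta_mx k l *m B) i j = A i k * B l j.
Proof.
rewrite -(mul_delta_mx (0 : 'I_1)) mulmxA -colE -mulmxA -rowE mxE big_ord1.
by rewrite !mxE.
Qed.

Section ProjectiveTrace.
Variables (R : realType) (n : nat).
Local Notation C := R[i].
Local Notation P := (PC R n).

Lemma mulmx_herm_delta (A B : 'M[C]_n) c k l :
  (A *m herm (c *: delta_mx k l) *m B) k l =
  2^-1 * (c * (A k k * B l l) + conjc c * (A k l * B k l)).
Proof.
have -> : herm (c *: delta_mx k l) =
    2^-1 *: (c *: delta_mx k l + conjc c *: delta_mx l k) :> 'M[C]_n.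
  by rewrite /herm ctrZ /ctr map_delta_mx trmx_delta.
by rewrite mulmx_entry_linear !mulmx_delta.
Qed.

Lemma ReD (x y : C) : complex.Re (x + y) = complex.Re x + complex.Re y.
Proof. by case: x y => [a b] [c d]. Qed.

Lemma Re_sum (I : finType) (f : I -> C) :
  complex.Re (\sum_i f i) = \sum_i complex.Re (f i).
Proof. exact: (big_morph _ ReD). Qed.

Lemma offdiag_herm_delta (S : 'M[C]_n) c k l (Q := 1%:M - S) :
  offdiag S (herm (c *: delta_mx k l)) k l =
  2^-1 * (c * (S k k * Q l l + Q k k * S l l) +
    conjc c * (S k l * Q k l + Q k l * S k l)).
Proof.
by rewrite [LHS]mxE !mulmx_herm_delta -mulrDr addrACA -!mulrDr.
Qed.

(** Of the four terms of [<tproj e, e>], two change sign when the basis vector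
[e] is multiplied by [i]. *)
Lemma edot_tproj_basis (S : cmx R n) k l (Q := 1%:M - S) :
  cmx_dot (PC_tproj S (cmx_basis R (k, l, true))) (cmx_basis R (k, l, true)) +
  cmx_dot (PC_tproj S (cmx_basis R (k, l, false))) (cmx_basis R (k, l, false)) =
  complex.Re (S k k * Q l l + Q k k * S l l).
Proof.
have s0 : Num.sqrt 2 != 0 :> R by rewrite sqrtr_eq0 -ltNge.
pose c (b : bool) : C := (Num.sqrt 2)%:C%C * (if b then 'i%C else 1).
have e b : cmx_dot (PC_tproj S (cmx_basis R (k, l, b))) (cmx_basis R (k, l, b)) =
    (Num.sqrt 2)^-1 * (if b then @complex.Im R else @complex.Re R)
      (2^-1 * (c b * (S k k * Q l l + Q k k * S l l) +
        conjc (c b) * (S k l * Q k l + Q k l * S k l))).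
  by rewrite -offdiag_herm_delta; exact: cmx_dot_basis.
apply: (etrans (congr2 +%R (e true) (e false))); clear e; rewrite /c.
have h : (2^-1 : C) = (2^-1)%:C%C by rewrite fmorphV rmorph_nat.
have ss : Num.sqrt 2 * Num.sqrt 2 = 2 :> R by rewrite -expr2 sqr_sqrtr.
rewrite h; move: (Num.sqrt 2) s0 ss => s s0 ss.
case: (S k k * Q l l + _) => a1 a2; case: (S k l * Q k l + _) => b1 b2 /=.
field; exact: s0.
Qed.

Lemma sum_triple (I J : finType) (F : I * J * bool -> R) :
  \sum_i F i = \sum_k \sum_l (F (k, l, true) + F (k, l, false)).
Proof.
rewrite (eq_bigr (fun i => F (i.1, i.2))) => [|[]] //.
rewrite -(pair_bigA _ (fun p b => F (p, b))) /=.
rewrite (eq_bigr (fun p => \sum_b F (p.1, p.2, b))) => [|[]] //.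
rewrite -(pair_bigA _ (fun k l => \sum_b F (k, l, b))) /=.
by apply: eq_bigr => k _; apply: eq_bigr => l _; rewrite big_bool.
Qed.

Lemma trace_product (F : comNzRingType) (A B : 'M[F]_n) :
  \sum_k \sum_l (A k k * B l l + B k k * A l l) = 2 * (\tr A * \tr B).
Proof.
under eq_bigr do rewrite big_split -!mulr_sumr /=.
by rewrite big_split -!mulr_suml /= -/(mxtrace A) -/(mxtrace B); ring.
Qed.

(** The trace of the projection onto the tangent space: the real dimension of
complex projective space. *)
Lemma sum_tproj_sqr (S : cmx R n) : points P S ->
  \sum_i edot (tproj (m := P) S (ebasis i)) (tproj (m := P) S (ebasis i)) =
  2 * (n%:R - 1).
Proof.
move=> PS.
pose F i := cmx_dot (PC_tproj S (cmx_basis R i)) (cmx_basis R i).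
transitivity (\sum_i F i).
  apply: eq_bigr => i _.
  exact: (etrans (esym (tproj_sym _ _ PS)) (congr1 (fun A => edot A _)
    (tproj_idem _ PS))).
rewrite sum_triple.
under eq_bigr do under eq_bigr do rewrite /F edot_tproj_basis.
have e (f : 'I_n -> 'I_n -> C) :
    \sum_k \sum_l complex.Re (f k l) = complex.Re (\sum_k \sum_l f k l).
  by rewrite Re_sum; apply: eq_bigr => k _; rewrite Re_sum.
rewrite e trace_product mxtraceD (_ : \tr (- (S : 'M[C]_n)) = - 1) ?mxtrace1.
  rewrite (point_tr PS) mul1r.
  have -> : (2 * (n%:R - 1) : C) = (2 * (n%:R - 1))%:C%C.
    by rewrite rmorphM rmorphB !rmorph_nat rmorph1.
  exact.
by rewrite linearN /= (point_tr PS).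
Qed.

(** The values of [<X, X>] are recovered from the matrix product, since the
compression of [X X] to a line is a multiple of the projector. *)
Lemma point_compress_sqr (S X : cmx R n) : points P S -> PC_tproj S X = X ->
  S *m X *m X = ((cmx_dot X X)%:C)%C *: (S : 'M[C]_n) /\
  X *m X *m S = ((cmx_dot X X)%:C)%C *: (S : 'M[C]_n).
Proof.
move=> PS /(tangentP PS) [hX tX]; have SS := point_id PS.
have SXX : S *m (X *m X) = X *m X *m S.
  have XS : X *m S = X - S *m X by rewrite -[X in X - _]tX addrK.
  rewrite -mulmxA XS mulmxBr !mulmxA XS mulmxBl; exact: (esym (subKr _ _)).
have SXXS : S *m X *m X *m S = S *m X *m X.
  by rewrite -!mulmxA (mulmxA X X S) -SXX mulmxA SS.
have tr2 : \tr (X *m X) = 2 * \tr (S *m X *m X).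
  have -> : X *m X = X *m S *m X + S *m X *m X by rewrite -mulmxDl tX.
  by rewrite mxtraceD -[X *m S *m X]mulmxA mxtrace_mulC -mulr2n mulr_natl.
have e : \tr (S *m X *m X) = ((cmx_dot X X)%:C)%C.
  have r : \tr (X *m X) = ((complex.Re (\tr (X *m X)))%:C)%C.
    by apply: tr_real; rewrite ctrM hX.
  have n2 : (2 : C) != 0 by rewrite pnatr_eq0.
  apply: (mulfI n2); rewrite -tr2 r /cmx_dot hX -(rmorph_nat (real_complex R)).
  by rewrite -rmorphM mulrA mulfV ?mul1r ?pnatr_eq0.
have f : S *m X *m X = \tr (S *m X *m X) *: (S : 'M[C]_n).
  by rewrite -[LHS]SXXS -(mulmxA S X X) (point_compress PS).
by rewrite -SXX mulmxA -e -f.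
Qed.

End ProjectiveTrace.

(** * Unit speed curves in the projective line *)

(** The polarized Cayley-Hamilton theorem for traceless matrices. *)
Lemma anticommutator_mx2 (F : comNzRingType) (A B : 'M[F]_2) :
  \tr A = 0 -> \tr B = 0 -> anticommutator A B = (\tr (A *m B))%:M.
Proof.
have e2 (f : 'I_2 -> F) : \sum_i f i = f ord0 + f (lift ord0 ord0).
  by rewrite big_ord_recl big_ord1.
have trE (D : 'M[F]_2) : \tr D = D ord0 ord0 + D (lift ord0 ord0) (lift ord0 ord0).
  exact: e2.
rewrite !trE => /eqP; rewrite addr_eq0 => /eqP hA /eqP; rewrite addr_eq0 => /eqP hB.
apply/matrixP => i j; rewrite /anticommutator !mxE !e2.
by case: (unliftP ord0 i) => [k|] ->; rewrite ?(ord1 k);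
  case: (unliftP ord0 j) => [l|] ->; rewrite ?(ord1 l) ?hA ?hB /=
  ?mulr1n ?mulr0n; ring.
Qed.

Lemma double_commutator n (F : comNzRingType) (X Y : 'M[F]_n) :
  X *m X = 1%:M -> anticommutator X Y = 0 ->
  commutator (commutator X Y) X = (- 4) *: Y.
Proof.
move=> XX /eqP; rewrite addr_eq0 => /eqP XY.
rewrite /commutator mulmxBl mulmxBr !mulmxA XX XY !mulNmx -!mulmxA XX.
rewrite mul1mx mulmx1; apply/matrixP => i j; rewrite !mxE; ring.
Qed.

Section ProjectiveLine.
Variable R : realType.
Local Notation C := R[i].

Lemma tangent_anticommutator (S X Y : cmx R 2) : points (PC R 2) S ->
  PC_tproj S X = X -> PC_tproj S Y = Y ->
  anticommutator X Y = ((2 * cmx_dot X Y)%:C)%C%:M.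
Proof.
move=> PS tX tY.
have trX := tangent_tr (point_id PS) (point_ctr PS) tX.
have trY := tangent_tr (point_id PS) (point_ctr PS) tY.
have [hX _] := (tangentP PS X).1 tX; have [hY _] := (tangentP PS Y).1 tY.
rewrite (anticommutator_mx2 trX trY) /cmx_dot hY mulrA mulfV ?pnatr_eq0 // mul1r.
have r : \tr (X *m Y) = conjc (\tr (X *m Y)).
  by rewrite -tr_ctr ctrM hX hY mxtrace_mulC.
congr (_%:M); case: (\tr _) r => a b [] /eqP.
by rewrite -addr_eq0 -mulr2n mulrn_eq0 /= => /eqP ->.
Qed.

(** The projective line has curvature 4: orthonormal tangent vectors are
anticommuting square roots of the identity. *)
Lemma curvature_projective_line (S X Y : cmx R 2) : points (PC R 2) S ->
  PC_tproj S X = X -> PC_tproj S Y = Y ->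
  cmx_dot X X = 1 -> cmx_dot X Y = 0 ->
  X *m X = 1%:M /\ commutator (commutator X Y) X = (- 4) *: (Y : 'M[C]_2).
Proof.
move=> PS tX tY XX XY.
have eXX := tangent_anticommutator PS tX tX.
have eXY := tangent_anticommutator PS tX tY.
have sq : X *m X = 1%:M.
  have n2 : (2 : C) != 0 by rewrite pnatr_eq0.
  apply: (scalerI n2); rewrite scaler_nat mulr2n.
  by rewrite [LHS]eXX XX mulr1 rmorph_nat scalemx1.
split=> //; apply: double_commutator => //.
by rewrite eXY XY mulr0 rmorph0 ?raddf0.
Qed.

(** ** The Frenet equations *)

Section Frenet.
Variables (I : set R) (I_open : open I).
Variables (gamma nu : R -> ambient (PC R 2)) (kappa : R -> R).
Hypothesis gamma_unit : unit_speed_curve I gamma.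
Hypothesis gamma_frenet : frenet I gamma nu kappa.
Local Notation E := (cmx_euclid R 2).
Local Notation T := (ederiv gamma).

Lemma edot_iter_ederiv (f : R -> E) k t i :
  edot (iter k (@ederiv R E) f t) (ebasis i) =
  derive1n k (fun s => edot (f s) (ebasis i)) t.
Proof.
elim: k t => [//|k IH] t; rewrite iterS edot_ederiv derive1nS.
by congr derive1; apply/funext => s; exact: IH.
Qed.

Lemma smooth_on_iter (f : R -> E) k t : smooth_on I f -> I t ->
  is_ederiv (iter k (@ederiv R E) f) t (iter k.+1 (@ederiv R E) f t).
Proof.
move=> sf It; apply: ederivable_is_ederiv => i.
under eq_fun do rewrite edot_iter_ederiv.
exact: sf.
Qed.

Lemma gamma_point t : I t -> points (PC R 2) (gamma t).
Proof. by move=> /gamma_unit.2 []. Qed.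

Lemma near_I t : I t -> \forall s \near t, I s.
Proof. by move=> It; exact: open_nbhs_nbhs. Qed.

Lemma is_ederiv_gamma t : I t -> is_ederiv gamma t (T t).
Proof. exact: (smooth_on_iter 0 gamma_unit.1). Qed.

Lemma is_ederiv_T t : I t -> is_ederiv T t (ederiv T t).
Proof. exact: (smooth_on_iter 1 gamma_unit.1). Qed.

Lemma is_ederiv_nu t : I t -> is_ederiv nu t (ederiv nu t).
Proof. exact: (smooth_on_iter 0 gamma_frenet.1). Qed.

Lemma ctr_linear n : real_linear (@ctr R n n : cmx_euclid R n -> cmx_euclid R n).
Proof.
split=> [A B|a A]; first exact: ctrD.
by apply: etrans (ctrZ _ _) _; rewrite conjc_real.
Qed.

Lemma is_ederiv_hermitian (f : R -> E) t v : I t ->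
  (forall s, I s -> ctr (f s) = f s) -> is_ederiv f t v -> ctr v = v.
Proof.
move=> It hf fv; apply: (is_ederiv_unique _ fv).
apply: is_ederiv_near (is_ederiv_linear (@ctr_linear 2) fv).
by near=> s; apply: hf; near: s; exact: near_I.
Unshelve. all: by end_near. Qed.

Lemma T_tangent t : I t -> PC_tproj (gamma t) (T t) = T t.
Proof.
move=> It; apply/(tangentP (gamma_point It)); split.
  apply: is_ederiv_hermitian (is_ederiv_gamma It) => // s Is.
  exact: point_ctr (gamma_point Is).
have dg := is_ederiv_gamma It.
apply: (is_ederiv_unique _ dg).
apply: is_ederiv_near (is_ederiv_mulmx dg dg).
near=> s; apply: point_id; apply: gamma_point; near: s; exact: near_I.
Unshelve. all: by end_near. Qed.

Lemma nu_tangent t : I t -> PC_tproj (gamma t) (nu t) = nu t.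
Proof. by move=> /gamma_frenet.2 []. Qed.

Lemma enorm_eq1 (v : E) : enorm v = 1 -> edot v v = 1.
Proof.
by move=> /(congr1 (fun x => x ^+ 2)); rewrite /enorm sqr_sqrtr ?edot_ge0 ?expr1n.
Qed.

Lemma edot_TT t : I t -> edot (T t) (T t) = 1.
Proof. by move=> /gamma_unit.2 [_ /enorm_eq1]. Qed.

Lemma edot_nunu t : I t -> edot (nu t) (nu t) = 1.
Proof. by move=> /gamma_frenet.2 [_ /enorm_eq1]. Qed.

Lemma edot_nuT t : I t -> edot (nu t) (T t) = 0.
Proof. by move=> /gamma_frenet.2 []. Qed.

Lemma tproj_T' t : I t -> PC_tproj (gamma t) (ederiv T t) = kappa t *: nu t.
Proof. by move=> /gamma_frenet.2 []. Qed.

Lemma kappaE t : I t -> kappa t = edot (ederiv T t) (nu t).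
Proof.
move=> It.
have e := tproj_sym (m := PC R 2) (ederiv T t) (nu t) (gamma_point It).
have e1 : edot (PC_tproj (gamma t) (ederiv T t) : E) (nu t) = kappa t.
  by rewrite tproj_T' // edotZl edot_nunu // mulr1.
have e2 : edot (ederiv T t) (PC_tproj (gamma t) (nu t) : E) =
    edot (ederiv T t) (nu t) by rewrite nu_tangent.
exact: (etrans (esym e1) (etrans e e2)).
Qed.

(** The curvature is [<gamma'', nu>], so it inherits the smoothness of [gamma]
and [nu]. *)
Lemma is_derive_kappa t : I t -> is_derive t (1 : R) kappa (derive1 kappa t).
Proof.
move=> It; rewrite derive1E; apply: derivableP.
have := is_derive_edot (smooth_on_iter 2 gamma_unit.1 It) (is_ederiv_nu It).
move=> d; apply: ex_derive; apply: near_eq_is_derive d.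
by near=> s; rewrite kappaE //; near: s; exact: near_I.
Unshelve. all: by end_near. Qed.

Lemma is_derive_kappa' t : I t ->
  is_derive t (1 : R) (derive1 kappa) (derive1 (derive1 kappa) t).
Proof.
move=> It; rewrite derive1E; apply: derivableP.
have d2 := smooth_on_iter 2 gamma_unit.1 It.
have d3 := smooth_on_iter 3 gamma_unit.1 It.
have n0 := smooth_on_iter 0 gamma_frenet.1 It.
have n1 := smooth_on_iter 1 gamma_frenet.1 It.
have := is_deriveD (is_derive_edot d3 n0) (is_derive_edot d2 n1).
move=> d; apply: ex_derive; apply: near_eq_is_derive d.
near=> s; have Is : I s by near: s; exact: near_I.
rewrite derive1E; apply/esym; apply: derive_val.
have := is_derive_edot (smooth_on_iter 2 gamma_unit.1 Is)
  (smooth_on_iter 0 gamma_frenet.1 Is).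
apply: near_eq_is_derive.
by near=> u; rewrite kappaE //; near: u; exact: near_I.
Unshelve. all: by end_near. Qed.

Lemma is_derive_constant_on (f : R -> R) c t v : I t ->
  (forall s, I s -> f s = c) -> is_derive t (1 : R) f v -> v = 0.
Proof.
move=> It fc fv; have fv' : is_derive t (1 : R) (cst c) v.
  apply: near_eq_is_derive fv.
  by near=> s; apply: fc; near: s; exact: near_I.
rewrite -(@derive_val _ _ _ _ _ _ _ fv').
exact: (@derive_val _ _ _ _ _ _ _ (is_derive_cst c t (1 : R))).
Unshelve. all: by end_near. Qed.

(** The second Frenet equation follows from the first, because [T] and [nu]
span the tangent plane of the projective line. *)
Lemma tproj_nu' t : I t -> PC_tproj (gamma t) (ederiv nu t) = - kappa t *: T t.
Proof.
move=> It; have Pg := gamma_point It.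
have dim : \sum_i edot (tproj (m := PC R 2) (gamma t) (ebasis i))
    (tproj (m := PC R 2) (gamma t) (ebasis i)) = 2.
  by rewrite sum_tproj_sqr //; ring.
have e := tproj_frame Pg (ederiv nu t) dim (T_tangent It) (nu_tangent It)
  (edot_TT It) (edot_nunu It) (edot_nuT It).
have n1 := is_derive_constant_on It edot_nunu (is_derive_edot (is_ederiv_nu It) (is_ederiv_nu It)).
have n2 := is_derive_constant_on It edot_nuT (is_derive_edot (is_ederiv_nu It) (is_ederiv_T It)).
have sym : edot (nu t) (ederiv nu t) = edot (ederiv nu t) (nu t) := edotC _ _.
have k : edot (nu t) (ederiv T t) = kappa t := etrans (edotC _ _) (esym (kappaE It)).
have dbl (x y : R) : y = x -> x + y = 0 -> x = 0.
  by move=> ->; rewrite -mulr2n => /eqP; rewrite mulrn_eq0 /= => /eqP.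
have {}n1 := dbl _ _ sym n1.
have {}n2 : edot (ederiv nu t) (T t) = - kappa t.
  by apply/eqP; rewrite -addr_eq0 -k; apply/eqP; exact: n2.
apply: (etrans e); rewrite n1 n2 scale0r addr0; exact.
Qed.

Lemma frenet_comb (V : lmodType R) (u v : V) a a' b b' k :
  a' *: u + a *: (k *: v) + (b' *: v + b *: (- k *: u)) =
  (a' - k * b) *: u + (b' + k * a) *: v.
Proof.
rewrite !scalerA !scalerDl mulrN (mulrC b) (mulrC a) (addrC (b' *: v)) addrACA.
by rewrite (addrC (_ *: v)).
Qed.

(** Both Frenet equations at once. The derivative [c] also has a normal part, but
only its tangential part survives in a covariant derivative; applying the lemma
twice gives the Hessian of the tension field in the direction of the curve. *)
Lemma frame_derivative (a b : R -> R) t a' b' : I t ->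
  is_derive t (1 : R) a a' -> is_derive t (1 : R) b b' ->
  exists c : cmx R 2, [/\ is_ederiv (fun s => a s *: T s + b s *: nu s) t c,
    ctr c = c &
    PC_tproj (gamma t) c =
      (a' - kappa t * b t) *: T t + (b' + kappa t * a t) *: nu t].
Proof.
move=> It da db.
have d := is_ederivD (is_ederivZ da (is_ederiv_T It)) (is_ederivZ db (is_ederiv_nu It)).
exists (a' *: T t + a t *: ederiv T t + (b' *: nu t + b t *: ederiv nu t)).
split; first exact: d.
  apply: is_ederiv_hermitian d => // s Is.
  have hT := (tangentP (gamma_point Is) _).1 (T_tangent Is).
  have hn := (tangentP (gamma_point Is) _).1 (nu_tangent Is).
  have [cD cZ] := @ctr_linear 2.
  apply: (etrans (cD _ _)); rewrite !cZ; congr (_ *: _ + _ *: _).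
    exact: hT.1.
  exact: hn.1.
apply: (etrans (real_linear_comb4 _ _ _ _ _ _ _ _ (tproj_linear (gamma t)))).
pose F (u v w x : E) := a' *: u + a t *: v + (b' *: w + b t *: x).
exact: (etrans (f_equal4 F (T_tangent It) (tproj_T' It) (nu_tangent It) (tproj_nu' It))
  (frenet_comb _ _ _ _ _ _ _)).
Qed.

End Frenet.

End ProjectiveLine.

(** ** The bitension field of the curve *)

Section CurveBitension.
Variables (R : realType) (I : set R) (I_open : open I).
Variables (gamma nu : R -> ambient (PC R 2)) (kappa : R -> R).
Hypothesis gamma_unit : unit_speed_curve I gamma.
Hypothesis gamma_frenet : frenet I gamma nu kappa.
Local Notation E := (cmx_euclid R 2).
Local Notation T := (ederiv gamma).
Local Notation M := (open_interval I_open).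
Local Notation kappa' := (derive1 kappa).
Local Notation kappa'' := (derive1 (derive1 kappa)).
Let gammaI : ambient M -> ambient (PC R 2) := gamma.
Let X : ambient M -> ambient M := tfield (M := M) (1 : R).

Lemma mtrace_interval (F : euclid R)
    (B : (ambient M -> ambient M) -> (ambient M -> ambient M) -> ambient M -> F) t :
  mtrace (M := M) B t = B X X t.
Proof. by rewrite /mtrace (big_pred1 tt) => [|[]]. Qed.

Lemma dirder_interval (F : euclid R) (V W : R -> F) t x c : I t ->
  (forall s, I s -> V s = W s) -> is_ederiv W t c ->
  dirder (M := M) V t x = (x : R) *: c.
Proof.
move=> It VW dW.
exact: (@dirder_eq R M F V W t x _ It erefl VW (is_ederiv_affine x dW)).
Qed.

Lemma conn_interval t : I t -> conn (M := M) X X t = 0.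
Proof.
move=> It; rewrite /conn /pconn.
have := @dirder_interval (real_line R) X X t 1 0 It (fun _ _ => erefl)
  (is_ederiv_cst (E := real_line R) (1 : R) t).
by rewrite scale1r.
Qed.

Lemma pconn_interval (V W : R -> E) t c : I t ->
  (forall s, I s -> V s = W s) -> is_ederiv W t c ->
  pconn (M := M) (N := PC R 2) gammaI X V t = PC_tproj (gamma t) c.
Proof.
move=> It VW dW; rewrite /pconn (dirder_interval _ It VW dW).
by apply: (congr1 (PC_tproj (gamma t))); exact: scale1r.
Qed.

Lemma dmap_gammaI t : I t -> dmap (M := M) (N := PC R 2) gammaI X t = T t.
Proof.
move=> It; have := dirder_interval (F := E) 1 It (fun _ _ => erefl)
  (is_ederiv_gamma gamma_unit It).
by rewrite scale1r.
Qed.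

Lemma pconn_conn_interval (V W : R -> E) t c : I t ->
  (forall s, I s -> V s = W s) -> is_ederiv W t c ->
  pconn (M := M) (N := PC R 2) gammaI (conn (M := M) X X) V t = 0.
Proof.
move=> It VW dW; rewrite /pconn (conn_interval It) (dirder_interval _ It VW dW).
by rewrite scale0r; exact: tproj0.
Qed.

Lemma tension_gammaI t : I t ->
  tension (M := M) (N := PC R 2) gammaI t = kappa t *: nu t.
Proof.
move=> It; rewrite /tension mtrace_interval /sff.
have e1 : pconn (M := M) (N := PC R 2) gammaI X
    (dmap (M := M) (N := PC R 2) gammaI X) t = kappa t *: nu t.
  apply: (etrans (pconn_interval It dmap_gammaI (is_ederiv_T gamma_unit It))).
  exact: (tproj_T' gamma_frenet It).
have e2 : dmap (M := M) (N := PC R 2) gammaI (conn (M := M) X X) t = 0.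
  rewrite /dmap (conn_interval It).
  rewrite (dirder_interval (F := E) 0 It (fun _ _ => erefl) (is_ederiv_gamma gamma_unit It)).
  exact: scale0r.
exact: (etrans (congr2 (fun u v : E => u - v) e1 e2) (subr0 _)).
Qed.

Definition frame (a b : R -> R) (t : R) : E := a t *: T t + b t *: nu t.

Lemma pconn_frame (V : R -> E) a b a' b' t : I t ->
  (forall s, I s -> V s = frame a b s) ->
  is_derive t (1 : R) a a' -> is_derive t (1 : R) b b' ->
  pconn (M := M) (N := PC R 2) gammaI X V t =
    (a' - kappa t * b t) *: T t + (b' + kappa t * a t) *: nu t.
Proof.
move=> It Vab da db.
have [c [dc _ pc]] := frame_derivative I_open gamma_unit gamma_frenet It da db.
exact: (etrans (pconn_interval It Vab dc) pc).
Qed.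

Lemma tension_frame t : I t ->
  tension (M := M) (N := PC R 2) gammaI t = frame (cst 0) kappa t.
Proof.
move=> It; rewrite (tension_gammaI It) /frame.
exact: (esym (etrans (congr1 (+%R^~ _) (scale0r _)) (add0r _))).
Qed.

Lemma pconn_tension t : I t ->
  pconn (M := M) (N := PC R 2) gammaI X (tension (M := M) (N := PC R 2) gammaI) t =
  frame (fun s => - (kappa s * kappa s)) kappa' t.
Proof.
move=> It.
apply: (etrans (pconn_frame It tension_frame (is_derive_cst 0 t (1 : R))
  (is_derive_kappa I_open gamma_unit gamma_frenet It))).
by rewrite /frame /cst /= mulr0 addr0 sub0r.
Qed.

Lemma is_derive_kappa_sqr t : I t -> is_derive t (1 : R)
  (fun s => - (kappa s * kappa s)) (- (2 * kappa t * kappa' t)).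
Proof.
move=> It; have dk := is_derive_kappa I_open gamma_unit gamma_frenet It.
apply: (is_derive_eq (is_deriveN (is_deriveM dk dk))).
by rewrite /GRing.scale /=; ring.
Qed.

(** The second covariant derivative of the tension field [kappa nu] along the
curve. *)
Definition frame_laplacian t : E :=
  (- (3 * kappa t * kappa' t)) *: T t + (kappa'' t - kappa t ^+ 3) *: nu t.

Lemma frame_laplacianE t :
  (- (2 * kappa t * kappa' t) - kappa t * kappa' t) *: T t +
    (kappa'' t + kappa t * - (kappa t * kappa t)) *: nu t = frame_laplacian t.
Proof.
rewrite /frame_laplacian.
have -> : - (2 * kappa t * kappa' t) - kappa t * kappa' t =
  - (3 * kappa t * kappa' t) by ring.
by have -> : kappa'' t + kappa t * - (kappa t * kappa t) =
  kappa'' t - kappa t ^+ 3 by ring.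
Qed.

Lemma hessian_tension t : I t ->
  hessian (M := M) (N := PC R 2) gammaI (tension (M := M) (N := PC R 2) gammaI) X X t =
  frame_laplacian t.
Proof.
move=> It; rewrite /hessian.
have e1 := pconn_frame It pconn_tension (is_derive_kappa_sqr It)
  (is_derive_kappa' I_open gamma_unit gamma_frenet It).
have [c [dc _ _]] := frame_derivative I_open gamma_unit gamma_frenet It
  (is_derive_cst 0 t (1 : R)) (is_derive_kappa I_open gamma_unit gamma_frenet It).
have e2 := pconn_conn_interval It tension_frame dc.
apply: (etrans (congr2 (fun u v : E => u - v) e1 e2)).
apply: (etrans (subr0 _)); exact: frame_laplacianE.
Qed.

Lemma curvature_tension t : I t ->
  commutator (commutator (T t) (kappa t *: nu t)) (T t) =
  ((- (4 * kappa t)) *: nu t : E).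
Proof.
move=> It.
have [_ e] := curvature_projective_line (gamma_point gamma_unit It)
  (T_tangent I_open gamma_unit It) (nu_tangent gamma_frenet It)
  (edot_TT gamma_unit It) (etrans (cmx_dotC _ _) (edot_nuT gamma_frenet It)).
rewrite !cmx_scaleE /commutator -scalemxAl -scalemxAr -scalerBr.
rewrite -scalemxAl -scalemxAr -scalerBr -/(commutator (T t) (nu t)).
rewrite -/(commutator (commutator (T t) (nu t)) (T t)) e scalerA.
congr (_ *: _); rewrite mulrN rmorphN rmorphM rmorph_nat mulrC; exact.
Qed.

Lemma bitension_gammaI t : I t ->
  bitension (M := M) (N := PC R 2) gammaI t =
  frame_laplacian t + (4 * kappa t) *: nu t.
Proof.
move=> It.
have Pg := gamma_point gamma_unit It.
have eR : curvature (M := PC R 2) (gamma t) (T t) (kappa t *: nu t) (T t) =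
    (- (4 * kappa t)) *: nu t.
  apply: (etrans (curvature_commutator _ _ _ Pg)).
  apply: (etrans _ (curvature_tension It)).
  have eT := T_tangent I_open gamma_unit It.
  have en : PC_tproj (gamma t) (kappa t *: nu t) = kappa t *: nu t.
    have [_ pZ] := tproj_linear (gamma t).
    by apply: (etrans (pZ _ _)); rewrite (nu_tangent gamma_frenet It); exact.
  exact: (f_equal3 (fun x y z => commutator (commutator x y) z) eT en eT).
have e : curvature (M := PC R 2) (gamma t)
    (dmap (M := M) (N := PC R 2) gammaI X t)
    (tension (M := M) (N := PC R 2) gammaI t)
    (dmap (M := M) (N := PC R 2) gammaI X t) = (- (4 * kappa t)) *: nu t.
  by rewrite (dmap_gammaI It) (tension_gammaI It).
apply: (etrans (congr2 (fun u v : E => - - u - v)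
  (etrans (mtrace_interval _ t) (hessian_tension It))
  (etrans (mtrace_interval _ t) e))).
by rewrite opprK scaleNr opprK.
Qed.

End CurveBitension.

(** * The Segre embedding *)

Section TensorAlgebra.
Variable F : comNzRingType.
Variables m n : nat.
Implicit Types (A C a c g : 'M[F]_m) (B D b P Y : 'M[F]_n).

Lemma tensmxDl A C B : tensmx (A + C) B = tensmx A B + tensmx C B.
Proof. by apply/matrixP => i j; rewrite !mxE mulrDl. Qed.

Lemma tensmxDr A B D : tensmx A (B + D) = tensmx A B + tensmx A D.
Proof. by apply/matrixP => i j; rewrite !mxE mulrDr. Qed.

Lemma tensmxZl x A B : tensmx (x *: A) B = x *: tensmx A B.
Proof. by apply/matrixP => i j; rewrite !mxE mulrA. Qed.

Lemma tensmxZr x A B : tensmx A (x *: B) = x *: tensmx A B.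
Proof. by apply/matrixP => i j; rewrite !mxE mulrCA. Qed.

Lemma tensmxNr A B : tensmx A (- B) = - tensmx A B.
Proof. by apply/matrixP => i j; rewrite !mxE mulrN. Qed.

Lemma tensmxNl A B : tensmx (- A) B = - tensmx A B.
Proof. by apply/matrixP => i j; rewrite !mxE mulNr. Qed.

Lemma tensmxBr A B D : tensmx A (B - D) = tensmx A B - tensmx A D.
Proof. by rewrite tensmxDr tensmxNr. Qed.

Lemma offdiag_tens g P a b : offdiag (tensmx g P) (tensmx a b) =
  tensmx (g *m a) (P *m b) + tensmx (a *m g) (b *m P) -
  (tensmx (g *m a *m g) (P *m b *m P)) *+ 2.
Proof.
rewrite /offdiag !(mulmxBr, mulmxBl) !mulmx1 !mul1mx !tensmx_mul.
by rewrite addrACA -opprD mulr2n.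
Qed.

(** For the tensor product of two projectors, a tensor product with one of them
is projected factor by factor: each factor of the Segre embedding is totally
geodesic. *)
Lemma offdiag_tensr g P a : P *m P = P ->
  offdiag (tensmx g P) (tensmx a P) = tensmx (offdiag g a) P.
Proof.
move=> PP; rewrite offdiag_tens !PP /offdiag !(mulmxBr, mulmxBl) !mulmx1 !mul1mx.
by rewrite addrACA -opprD mulr2n !(tensmxDl, tensmxNl).
Qed.

Lemma offdiag_tensl g P b : g *m g = g ->
  offdiag (tensmx g P) (tensmx g b) = tensmx g (offdiag P b).
Proof.
move=> gg; rewrite offdiag_tens !gg /offdiag !(mulmxBr, mulmxBl) !mulmx1 !mul1mx.
by rewrite addrACA -opprD mulr2n !(tensmxDr, tensmxNr).
Qed.

Lemma offdiag_tens0 g P a b : g *m a *m g = 0 ->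
  offdiag (tensmx g P) (tensmx a b) =
  tensmx (g *m a) (P *m b) + tensmx (a *m g) (b *m P).
Proof. by move=> gag; rewrite offdiag_tens gag tens0mx mul0rn subr0. Qed.

Lemma commutator_tens a c P : P *m P = P ->
  commutator (commutator (tensmx a P) (tensmx c P)) (tensmx a P) =
  tensmx (commutator (commutator a c) a) P.
Proof.
move=> PP; rewrite /commutator !(mulmxBl, mulmxBr) !tensmx_mul !PP.
by rewrite !(tensmxDl, tensmxNl).
Qed.

(** Of the four products in the double commutator, those that contain [g c g]
vanish and the two others add up to [c]. *)
Lemma commutator_tens_split g c P Y (s : F) :
  g *m g = g -> g *m c *m g = 0 -> c *m g + g *m c = c ->
  P *m Y *m Y = s *: P -> Y *m Y *m P = s *: P ->
  commutator (commutator (tensmx g Y) (tensmx c P)) (tensmx g Y) =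
  - (s *: tensmx c P).
Proof.
move=> gg gcg tc PYY YYP.
rewrite /commutator !(mulmxBl, mulmxBr) !tensmx_mul -!(mulmxA _ g g) !gg.
rewrite !mulmxA gg gcg tens0mx sub0r subr0 PYY YYP !tensmxZr -opprD -scalerDr.
by rewrite -tensmxDl tc.
Qed.

(** The left-hand side is the Hessian, in the direction [Y] of the second factor,
of a field [c] tangent to the first one; [D] is the derivative of the field [Y]
along itself. Compressing the relation on [D] by [P] gives [P D P = - 2 P Y Y P],
which is a multiple of [P]. *)
Lemma hessian_tens g c P Y D (s : F) :
  g *m c *m g = 0 -> c *m g + g *m c = c -> P *m P = P ->
  D = D *m P + P *m D + anticommutator Y Y ->
  P *m Y *m Y = s *: P -> Y *m Y *m P = s *: P ->
  tensmx (g *m c) (P *m (Y *m Y + P *m D)) +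
    tensmx (c *m g) ((D *m P + Y *m Y) *m P) -
    (tensmx (g *m c) (P *m offdiag P D) + tensmx (c *m g) (offdiag P D *m P)) =
  - (s *: tensmx c P).
Proof.
move=> gcg tc PP eD PYY YYP.
have PYYP : P *m Y *m Y *m P = s *: P by rewrite PYY -scalemxAl PP.
have PDP : P *m D *m P = - (s *: P) - s *: P.
  have h : P *m D *m P = P *m D *m P + (P *m D *m P + (s *: P + s *: P)).
    rewrite {1}eD /anticommutator !(mulmxDr, mulmxDl) !mulmxA !PP.
    by rewrite -!(mulmxA _ P P) !PP PYYP !addrA.
  move: h; rewrite -[X in X = _]addr0 => /addrI/esym/eqP.
  by rewrite addr_eq0 => /eqP ->; rewrite opprD.
have e1 : P *m (Y *m Y + P *m D) - P *m offdiag P D = - (s *: P).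
  rewrite /offdiag !(mulmxDr, mulmxBr, mulmxDl, mulmxBl, mulmxN, mulNmx) !mulmx1 !mul1mx !mulmxA.
  rewrite !PP PYY PDP; apply/matrixP => i j; rewrite !mxE; ring.
have e2 : (D *m P + Y *m Y) *m P - offdiag P D *m P = - (s *: P).
  rewrite /offdiag !(mulmxDr, mulmxBr, mulmxDl, mulmxBl, mulmxN, mulNmx) !mulmx1 !mul1mx.
  rewrite -!(mulmxA _ P P) !PP YYP PDP; apply/matrixP => i j; rewrite !mxE; ring.
rewrite opprD addrACA -!tensmxNr -!tensmxDr e1 e2 -tensmxDl.
by rewrite tensmxNr tensmxZr (addrC (g *m c)) tc.
Qed.

End TensorAlgebra.

(** ** The product as a submanifold *)

Lemma ctr_tens (R : realType) m n (A : 'M[R[i]]_m) (B : 'M[R[i]]_n) :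
  ctr (tensmx A B) = tensmx (ctr A) (ctr B).
Proof. by apply/matrixP => i j; rewrite !mxE rmorphM. Qed.

Lemma is_ederiv_tens (R : realType) m n (f : R -> cmx R m) (g : R -> cmx R n) t u v :
  is_ederiv (E := cmx_euclid R m) f t u -> is_ederiv (E := cmx_euclid R n) g t v ->
  is_ederiv (E := cmx_euclid R (m * n)) (fun s => tensmx (f s) (g s)) t
    (tensmx u (g t) + tensmx (f t) v).
Proof.
apply: (@is_ederiv_bilinear R (cmx_euclid R m) (cmx_euclid R n)
  (cmx_euclid R (m * n)) (fun A B => tensmx A B)) => A; split=> [B D|a B].
- exact: tensmxDl.
- exact: tensmxZl.
- exact: tensmxDr.
- exact: tensmxZr.
Qed.

Section Segre.
Variables (R : realType) (I : set R) (I_open : open I) (n : nat).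
Variables (gamma nu : R -> ambient (PC R 2)) (kappa : R -> R).
Hypothesis gamma_unit : unit_speed_curve I gamma.
Hypothesis gamma_frenet : frenet I gamma nu kappa.
Local Notation E := (cmx_euclid R 2).
Local Notation EN := (cmx_euclid R (2 * n)).
Local Notation T := (ederiv gamma).
Local Notation M := (manifold_prod (open_interval I_open) (PC R n)).
Local Notation N := (PC R (2 * n)).
Local Notation kappa' := (derive1 kappa).
Local Notation kappa'' := (derive1 (derive1 kappa)).
Let phi : ambient M -> ambient N := fun p => segre (gamma p.1, p.2).
Local Notation X0 := (tfield (M := M) (1 : R, 0 : cmx R n)).
Local Notation XP y := (tfield (M := M) (0 : R, y : cmx R n)).

Lemma mtrace_prod (F : euclid R)
    (B : (ambient M -> ambient M) -> (ambient M -> ambient M) -> ambient M -> F) p :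
  mtrace (M := M) B p = B X0 X0 p + \sum_k B (XP (cmx_basis R k)) (XP (cmx_basis R k)) p.
Proof. by rewrite /mtrace big_sumType /= (big_pred1 tt) => [|[]]. Qed.

Lemma dirder_prod (F : euclid R) (V W : ambient M -> F) t P a A v :
  I t -> points (PC R n) P -> PC_tproj P A = A ->
  (forall q, points M q -> V q = W q) ->
  is_ederiv (fun s => W (t + s * a, PC_curve P A s)) 0 v ->
  dirder (M := M) V (t, P) (a, A) = v.
Proof.
move=> It PP tA VW dW.
exact: (@dirder_eq R M F V W (t, P) (a, A) v (conj It PP) (congr1 (pair a) tA) VW dW).
Qed.

Lemma dirder_tens (V : ambient M -> EN) (c : R -> E) t P a A c' :
  I t -> points (PC R n) P -> PC_tproj P A = A ->
  (forall q, points M q -> V q = tensmx (c q.1) q.2) -> is_ederiv c t c' ->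
  dirder (M := M) V (t, P) (a, A) = a *: (tensmx c' P : EN) + tensmx (c t) A.
Proof.
move=> It PP tA Vc dc.
have d := is_ederiv_tens (is_ederiv_affine a dc) (is_ederiv_curve (M := PC R n) PP tA).
apply: (@dirder_prod EN V (fun q => tensmx (c q.1) q.2) t P a A _ It PP tA Vc).
apply: (is_ederiv_eq d).
rewrite mul0r addr0.
congr (_ + _).
rewrite (curve0 _ PP).
exact: tensmxZl.
Qed.

Lemma point_segre (A : cmx R 2) (B : cmx R n) :
  points (PC R 2) A -> points (PC R n) B -> points N (tensmx A B).
Proof.
move=> PA PB; have tr1 : \tr (tensmx A B) = 1.
  by rewrite mxtrace_tens (point_tr PA) (point_tr PB) mulr1.
have [z _ eA] := PA; have [w _ eB] := PB.
have eS : tensmx A B = line (tensmx z w : 'cV_(2 * n)).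
  by rewrite eA eB; exact: (segre_line z w).
exists (tensmx z w : 'cV_(2 * n)); last exact: eS.
apply/eqP => zw0; move: tr1; rewrite eS zw0 /line mul0mx scaler0 mxtrace0.
by move=> /esym/eqP; rewrite oner_eq0.
Qed.

Lemma X0E q : X0 q = (1, 0).
Proof. exact: (congr1 (pair (1 : R)) (tproj0 q.2)). Qed.

Section Point.
Variables (t : R) (P : cmx R n).
Hypotheses (It : I t) (PP : points (PC R n) P).
Let Pg : points (PC R 2) (gamma t) := gamma_point gamma_unit It.
Let S : cmx R (2 * n) := tensmx (gamma t) P.
Let PS : points N S := point_segre Pg PP.
Let t0 : PC_tproj P 0 = 0 := tproj0 P.

Lemma tproj_tensr (c : cmx R 2) : ctr c = c ->
  PC_tproj S (tensmx c P) = tensmx (PC_tproj (gamma t) c) P.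
Proof.
move=> hc; rewrite (tproj_herm _ hc).
apply: (etrans (tproj_herm _ _)); first by rewrite ctr_tens hc (point_ctr PP).
exact: (offdiag_tensr _ _ (point_id PP)).
Qed.

Lemma tproj_tensl (b : cmx R n) : ctr b = b ->
  PC_tproj S (tensmx (gamma t) b) = tensmx (gamma t) (PC_tproj P b).
Proof.
move=> hb; rewrite (tproj_herm _ hb).
apply: (etrans (tproj_herm _ _)); first by rewrite ctr_tens hb (point_ctr Pg).
exact: (offdiag_tensl _ _ (point_id Pg)).
Qed.

(** Moving a vector tangent to the first factor along the second one produces
matrices of this form. Since [c] exchanges the image and the kernel of
[gamma t], the projection onto the tangent space only acts on the second
factor. *)
Lemma tproj_mixed (c : cmx R 2) (b d : cmx R n) :
  PC_tproj (gamma t) c = c -> ctr b = d ->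
  PC_tproj S (tensmx (gamma t *m c) b + tensmx (c *m gamma t) d) =
  tensmx (gamma t *m c) (P *m b) + tensmx (c *m gamma t) (d *m P).
Proof.
move=> tc hb; have [hc sc] := (tangentP Pg c).1 tc.
have gg := point_id Pg; have hg := point_ctr Pg.
have gcg := tangent_compress0 gg sc.
have hd : ctr d = b by rewrite -hb ctrK.
apply: (etrans (tproj_herm _ _)).
  by rewrite ctrD !ctr_tens !ctrM hg hc hb hd addrC.
rewrite offdiagD !offdiag_tens0 ?mulmxA ?gg ?gcg ?mul0mx //.
by rewrite -(mulmxA c) gg !tens0mx addr0 add0r.
Qed.

Lemma tproj_tens_tangent (c : cmx R 2) (A : cmx R n) :
  PC_tproj (gamma t) c = c -> PC_tproj P A = A ->
  PC_tproj S (tensmx c A) =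
  tensmx (gamma t *m c) (P *m A) + tensmx (c *m gamma t) (A *m P).
Proof.
move=> tc tA; have [hc sc] := (tangentP Pg c).1 tc.
have [hA _] := (tangentP PP A).1 tA.
rewrite -(tproj_mixed tc hA); congr PC_tproj.
by rewrite -tensmxDl addrC sc.
Qed.

Lemma conn_X0 : conn (M := M) X0 X0 (t, P) = (0, 0).
Proof.
rewrite /conn /pconn [X0 (t, P)]X0E.
have -> : dirder (M := M) X0 (t, P) (1, 0) = 0.
  apply: (@dirder_prod (ambient M) X0 (fun=> (1, 0)) t P 1 0 0 It PP t0).
    by move=> q _; exact: X0E.
  exact: (is_ederiv_cst (E := ambient M)).
exact: (congr1 (pair (0 : R)) t0).
Qed.

Lemma conn_XP (y : cmx R n) (Y := PC_tproj P y) :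
  conn (M := M) (XP y) (XP y) (t, P) = (0, PC_tproj P (doffdiag P (herm y) Y)).
Proof.
have tY : PC_tproj P Y = Y := tangent_tproj PP y.
rewrite /conn /pconn.
have -> : dirder (M := M) (XP y) (t, P) (XP y (t, P)) = (0, doffdiag P (herm y) Y).
  apply: (@dirder_prod (ambient M) (XP y) (XP y) t P 0 Y _ It PP tY
    (fun _ _ => erefl)).
  exact: (is_ederiv_pair (E := real_line R) (is_ederiv_cst _ _)
    (is_ederiv_tfield PP y tY)).
exact.
Qed.

Lemma dmap_phi (X : ambient M -> ambient M) a A : X (t, P) = (a, A) ->
  PC_tproj P A = A ->
  dmap (M := M) (N := N) phi X (t, P) =
  a *: (tensmx (T t) P : EN) + tensmx (gamma t) A.
Proof.
move=> eX tA; rewrite /dmap eX.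
exact: (dirder_tens a It PP tA (fun _ _ => erefl) (is_ederiv_gamma gamma_unit It)).
Qed.

Lemma dmap_X0 : dmap (M := M) (N := N) phi X0 (t, P) = tensmx (T t) P.
Proof.
apply: (etrans (dmap_phi (X0E _) t0)).
by rewrite scale1r tensmx0 addr0.
Qed.

Lemma dmap_XP (y : cmx R n) :
  dmap (M := M) (N := N) phi (XP y) (t, P) = tensmx (gamma t) (PC_tproj P y).
Proof.
apply: (etrans (dmap_phi (X := XP y) erefl (tangent_tproj PP y))).
by rewrite scale0r add0r.
Qed.

End Point.

Lemma ctr_T' t : I t -> ctr (ederiv T t) = ederiv T t.
Proof.
move=> It; apply: (is_ederiv_hermitian I_open It _ (is_ederiv_T gamma_unit It)).
move=> s Is; have Pg := gamma_point gamma_unit Is.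
exact: ((tangentP Pg _).1 (T_tangent I_open gamma_unit Is)).1.
Qed.

(** For the derivatives along the projective factor, on which the time stays
fixed. *)
Lemma is_ederiv_still (F : euclid R) (f : R -> F) t :
  is_ederiv (fun s => f (t + s * 0)) 0 0.
Proof.
have -> : (fun s => f (t + s * 0)) = (fun=> f t).
  by apply/funext => s; rewrite mulr0 addr0.
exact: is_ederiv_cst.
Qed.

Lemma pconn_X0 (V : ambient M -> EN) (c : R -> E) t P c' :
  I t -> points (PC R n) P -> (forall q, points M q -> V q = tensmx (c q.1) q.2) ->
  is_ederiv c t c' -> ctr c' = c' ->
  pconn (M := M) (N := N) phi X0 V (t, P) = tensmx (PC_tproj (gamma t) c') P.
Proof.
move=> It PP Vc dc hc; apply: (etrans _ (tproj_tensr t PP hc)).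
apply: (congr1 (PC_tproj (tensmx (gamma t) P))); rewrite X0E.
apply: (etrans (dirder_tens 1 It PP (tproj0 P) Vc dc)).
by rewrite scale1r tensmx0 addr0.
Qed.

Lemma pconn_tens0 (X : ambient M -> ambient M) (V : ambient M -> EN) (c : R -> E)
    t P A :
  I t -> points (PC R n) P -> (forall q, points M q -> V q = tensmx (c q.1) q.2) ->
  PC_tproj (gamma t) (c t) = c t -> X (t, P) = (0, A) -> PC_tproj P A = A ->
  pconn (M := M) (N := N) phi X V (t, P) =
    tensmx (gamma t *m c t) (P *m A) + tensmx (c t *m gamma t) (A *m P).
Proof.
move=> It PP Vc tc eX tA.
apply: (etrans _ (tproj_tens_tangent It PP tc tA)).
apply: (congr1 (PC_tproj (tensmx (gamma t) P))); rewrite eX.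
apply: (@dirder_prod EN V (fun q => tensmx (c q.1) q.2) t P 0 A _ It PP tA Vc).
apply: (is_ederiv_eq (is_ederiv_tens (is_ederiv_still (F := E) c t)
  (is_ederiv_curve (M := PC R n) PP tA))).
by rewrite mulr0 addr0 tens0mx add0r.
Qed.

Lemma pconn_conn_X0 (V : ambient M -> EN) (c : R -> E) t P :
  I t -> points (PC R n) P -> (forall q, points M q -> V q = tensmx (c q.1) q.2) ->
  PC_tproj (gamma t) (c t) = c t ->
  pconn (M := M) (N := N) phi (conn (M := M) X0 X0) V (t, P) = 0.
Proof.
move=> It PP Vc tc.
apply: (etrans (pconn_tens0 It PP Vc tc (conn_X0 It PP) (tproj0 P))).
by rewrite mulmx0 mul0mx !tensmx0 addr0.
Qed.

Lemma sff_X0 t P : I t -> points (PC R n) P ->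
  sff (M := M) (N := N) phi X0 X0 (t, P) = tensmx (kappa t *: nu t) P.
Proof.
move=> It PP; rewrite /sff.
have dX0 q : points M q -> dmap (M := M) (N := N) phi X0 q = tensmx (T q.1) q.2.
  by case: q => s Q [Is PQ]; exact: dmap_X0 Is PQ.
have e1 := pconn_X0 It PP dX0 (is_ederiv_T gamma_unit It) (ctr_T' It).
have e2 := dmap_phi It PP (conn_X0 It PP) (tproj0 P).
apply: (etrans (congr2 (fun u v : EN => u - v) e1 e2)).
rewrite scale0r tensmx0 addr0 subr0; apply: (congr1 (fun A : cmx R 2 => (tensmx A P : EN))).
exact: (tproj_T' gamma_frenet It).
Qed.

Lemma sff_XP t P y : I t -> points (PC R n) P ->
  sff (M := M) (N := N) phi (XP y) (XP y) (t, P) = 0.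
Proof.
move=> It PP; rewrite /sff.
have tY := tangent_tproj PP y; set Y := PC_tproj P y in tY.
have hY : ctr Y = Y := ctr_tproj PP y.
have hD := ctr_doffdiag (point_ctr PP) (ctr_herm y) hY.
have dXP q : points M q -> dmap (M := M) (N := N) phi (XP y) q =
    tensmx (gamma q.1) (PC_tproj q.2 y).
  by case: q => s Q [Is PQ]; exact: dmap_XP Is PQ y.
have e1 : pconn (M := M) (N := N) phi (XP y) (dmap (M := M) (N := N) phi (XP y)) (t, P) =
    tensmx (gamma t) (PC_tproj P (doffdiag P (herm y) Y)).
  apply: (etrans _ (tproj_tensl P It hD)).
  apply: (congr1 (PC_tproj (tensmx (gamma t) P))).
  apply: (@dirder_prod EN _ (fun q => tensmx (gamma q.1) (PC_tproj q.2 y))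
    t P 0 Y _ It PP tY dXP).
  apply: (is_ederiv_eq (is_ederiv_tens (is_ederiv_still (F := E) gamma t)
    (is_ederiv_tfield PP y tY))).
  by rewrite mulr0 addr0 tens0mx add0r.
have e2 := dmap_phi It PP (conn_XP It PP y) (tangent_tproj PP _).
apply: (etrans (congr2 (fun u v : EN => u - v) e1 e2)).
rewrite scale0r add0r; exact: subrr.
Qed.

Lemma tension_phi t P : I t -> points (PC R n) P ->
  tension (M := M) (N := N) phi (t, P) = tensmx (kappa t *: nu t) P.
Proof.
move=> It PP; apply: (etrans (mtrace_prod _ _)).
have e : \sum_k sff (M := M) (N := N) phi (XP (cmx_basis R k)) (XP (cmx_basis R k))
    (t, P) = 0 by apply: big1 => k _; exact: sff_XP.
exact: (etrans (congr2 (fun u v : EN => u + v) (sff_X0 It PP) e) (addr0 _)).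
Qed.

Lemma hessian_XP (V : ambient M -> EN) (c : R -> E) t P y :
  I t -> points (PC R n) P -> (forall q, points M q -> V q = tensmx (c q.1) q.2) ->
  (forall s, I s -> PC_tproj (gamma s) (c s) = c s) ->
  hessian (M := M) (N := N) phi V (XP y) (XP y) (t, P) =
  - (cmx_dot (PC_tproj P y) (PC_tproj P y) *: (tensmx (c t) P : EN)).
Proof.
move=> It PP Vc tc; rewrite /hessian.
have Pg := gamma_point gamma_unit It.
have tY := tangent_tproj PP y; set Y := PC_tproj P y in tY *.
have hY : ctr Y = Y := ctr_tproj PP y.
set D := doffdiag P (herm y) Y.
have hD : ctr D = D := ctr_doffdiag (point_ctr PP) (ctr_herm y) hY.
have tPD : PC_tproj P D = offdiag P D := tproj_herm P hD.
have dXP q : points M q -> pconn (M := M) (N := N) phi (XP y) V q =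
    tensmx (gamma q.1 *m c q.1) (q.2 *m PC_tproj q.2 y) +
    tensmx (c q.1 *m gamma q.1) (PC_tproj q.2 y *m q.2).
  case: q => s Q [Is PQ].
  exact: (pconn_tens0 (X := XP y) Is PQ Vc (tc s Is) erefl (tangent_tproj PQ y)).
have hb : ctr (Y *m Y + P *m D) = D *m P + Y *m Y.
  by rewrite ctrD !ctrM hY hD (point_ctr PP) addrC.
have e1 : pconn (M := M) (N := N) phi (XP y) (pconn (M := M) (N := N) phi (XP y) V) (t, P) =
    tensmx (gamma t *m c t) (P *m (Y *m Y + P *m D)) +
    tensmx (c t *m gamma t) ((D *m P + Y *m Y) *m P).
  apply: (etrans _ (tproj_mixed P It (tc t It) hb)).
  apply: (congr1 (PC_tproj (tensmx (gamma t) P))).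
  apply: (@dirder_prod EN _ _ t P 0 Y _ It PP tY dXP).
  have dP := is_ederiv_curve (M := PC R n) PP tY.
  have dY := is_ederiv_tfield PP y tY.
  have e0 := PC_curve0 PP Y.
  have dl := is_ederiv_tens
    (is_ederiv_still (F := E) (fun s => gamma s *m c s) t) (is_ederiv_mulmx dP dY).
  have dr := is_ederiv_tens
    (is_ederiv_still (F := E) (fun s => c s *m gamma s) t) (is_ederiv_mulmx dY dP).
  apply: (is_ederiv_eq (is_ederivD dl dr)).
  rewrite mulr0 addr0 !tens0mx !add0r.
  exact: (congr1 (fun Q => tensmx (gamma t *m c t) (Y *m PC_tproj Q y + Q *m D) +
    tensmx (c t *m gamma t) (D *m Q + PC_tproj Q y *m Y)) e0).
have e2 := pconn_tens0 It PP Vc (tc t It) (conn_XP It PP y) (tangent_tproj PP _).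
apply: (etrans (congr2 (fun u v : EN => u - v) e1 e2)).
have [_ sY] := (tangentP PP Y).1 tY.
have [_ sc] := (tangentP Pg _).1 (tc t It).
have [PYY YYP] := point_compress_sqr PP tY.
have eD := doffdiag_split (point_id PP) sY (herm y).
rewrite /= -/Y -/D tPD.
exact: (hessian_tens (tangent_compress0 (point_id Pg) sc) sc (point_id PP) eD PYY YYP).
Qed.

Lemma pconn_frame_X0 (V : ambient M -> EN) a b a' b' t P :
  I t -> points (PC R n) P ->
  (forall q, points M q -> V q = tensmx (frame gamma nu a b q.1) q.2) ->
  is_derive t (1 : R) a a' -> is_derive t (1 : R) b b' ->
  pconn (M := M) (N := N) phi X0 V (t, P) =
  tensmx ((a' - kappa t * b t) *: T t + (b' + kappa t * a t) *: nu t) P.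
Proof.
move=> It PP Vab da db.
have [c [dc hc pc]] := frame_derivative I_open gamma_unit gamma_frenet It da db.
apply: (etrans (pconn_X0 It PP Vab dc hc)).
exact: (congr1 (fun A : cmx R 2 => (tensmx A P : EN)) pc).
Qed.

Lemma tension_frame_phi q : points M q ->
  tension (M := M) (N := N) phi q = tensmx (frame gamma nu (cst 0) kappa q.1) q.2.
Proof.
case: q => t P [It PP]; rewrite (tension_phi It PP).
apply: (congr1 (fun A : cmx R 2 => (tensmx A P : EN))).
exact: (esym (etrans (congr1 (+%R^~ _) (scale0r _)) (add0r _))).
Qed.

Lemma frame_tangent a b t : I t ->
  PC_tproj (gamma t) (frame gamma nu a b t) = frame gamma nu a b t.
Proof.
move=> It; have [pD pZ] := tproj_linear (gamma t).
apply: (etrans (pD _ _)).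
exact: (congr2 (fun u v : E => u + v)
  (etrans (pZ _ _) (congr1 ( *:%R (a t)) (T_tangent I_open gamma_unit It)))
  (etrans (pZ _ _) (congr1 ( *:%R (b t)) (nu_tangent gamma_frenet It)))).
Qed.

Lemma pconn_tension_phi q : points M q ->
  pconn (M := M) (N := N) phi X0 (tension (M := M) (N := N) phi) q =
  tensmx (frame gamma nu (fun s => - (kappa s * kappa s)) kappa' q.1) q.2.
Proof.
case: q => t P [It PP].
apply: (etrans (pconn_frame_X0 It PP tension_frame_phi (is_derive_cst 0 t (1 : R))
  (is_derive_kappa I_open gamma_unit gamma_frenet It))).
apply: (congr1 (fun A : cmx R 2 => (tensmx A P : EN))).
by rewrite /frame /cst /= mulr0 addr0 sub0r.
Qed.

Lemma hessian_X0 t P : I t -> points (PC R n) P ->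
  hessian (M := M) (N := N) phi (tension (M := M) (N := N) phi) X0 X0 (t, P) =
  tensmx (frame_laplacian gamma nu kappa t) P.
Proof.
move=> It PP; rewrite /hessian.
have e1 := pconn_frame_X0 It PP pconn_tension_phi
  (is_derive_kappa_sqr I_open gamma_unit gamma_frenet It)
  (is_derive_kappa' I_open gamma_unit gamma_frenet It).
have e2 := pconn_conn_X0 It PP tension_frame_phi (frame_tangent _ _ It).
apply: (etrans (congr2 (fun u v : EN => u - v) e1 e2)).
rewrite subr0; apply: (congr1 (fun A : cmx R 2 => (tensmx A P : EN))).
exact: frame_laplacianE.
Qed.

Lemma curvature_X0 t P : I t -> points (PC R n) P ->
  curvature (M := N) (phi (t, P)) (dmap (M := M) (N := N) phi X0 (t, P))
    (tension (M := M) (N := N) phi (t, P)) (dmap (M := M) (N := N) phi X0 (t, P)) =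
  tensmx ((- (4 * kappa t)) *: nu t) P.
Proof.
move=> It PP; have Pg := gamma_point gamma_unit It.
have PS := point_segre Pg PP.
rewrite (dmap_X0 It PP) (tension_phi It PP).
apply: (etrans (curvature_commutator _ _ _ PS)).
have hT := T_tangent I_open gamma_unit It.
have hn : PC_tproj (gamma t) (kappa t *: nu t) = kappa t *: nu t.
  apply: (etrans ((tproj_linear (gamma t)).2 _ _)).
  exact: (congr1 ( *:%R (kappa t)) (nu_tangent gamma_frenet It)).
pose L (A : cmx R 2) := tensmx A P : cmx R (2 * n).
have eT := etrans (tproj_tensr t PP ((tangentP Pg _).1 hT).1) (congr1 L hT).
have en := etrans (tproj_tensr t PP ((tangentP Pg _).1 hn).1) (congr1 L hn).
apply: (etrans (f_equal3 (fun x y z => commutator (commutator x y) z) eT en eT)).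
apply: (etrans (commutator_tens _ _ (point_id PP))).
exact: (congr1 L (curvature_tension I_open gamma_unit gamma_frenet It)).
Qed.

Lemma curvature_XP t P y : I t -> points (PC R n) P ->
  curvature (M := N) (phi (t, P)) (dmap (M := M) (N := N) phi (XP y) (t, P))
    (tension (M := M) (N := N) phi (t, P)) (dmap (M := M) (N := N) phi (XP y) (t, P)) =
  - (cmx_dot (PC_tproj P y) (PC_tproj P y) *: (tensmx (kappa t *: nu t) P : EN)).
Proof.
move=> It PP; have Pg := gamma_point gamma_unit It.
have PS := point_segre Pg PP.
rewrite (dmap_XP It PP) (tension_phi It PP).
apply: (etrans (curvature_commutator _ _ _ PS)).
have hn : PC_tproj (gamma t) (kappa t *: nu t) = kappa t *: nu t.
  apply: (etrans ((tproj_linear (gamma t)).2 _ _)).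
  exact: (congr1 ( *:%R (kappa t)) (nu_tangent gamma_frenet It)).
have tY := tangent_tproj PP y.
pose L (A : cmx R 2) := tensmx A P : cmx R (2 * n).
pose L' (A : cmx R n) := tensmx (gamma t) A : cmx R (2 * n).
have eY := etrans (tproj_tensl P It (ctr_tproj PP y)) (congr1 L' tY).
have en := etrans (tproj_tensr t PP ((tangentP Pg _).1 hn).1) (congr1 L hn).
apply: (etrans (f_equal3 (fun x y z => commutator (commutator x y) z) eY en eY)).
have [_ sn] := (tangentP Pg _).1 hn.
have [PYY YYP] := point_compress_sqr PP tY.
exact: (commutator_tens_split (point_id Pg) (tangent_compress0 (point_id Pg) sn)
  sn PYY YYP).
Qed.

(** The projective factor contributes nothing: in each of its directions [Y], the
Hessian of the tension field and the curvature term are both the tension field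
times minus the squared norm of [Y]. *)
Lemma bitension_phi t P : I t -> points (PC R n) P ->
  bitension (M := M) (N := N) phi (t, P) =
  tensmx (frame_laplacian gamma nu kappa t + (4 * kappa t) *: nu t) P.
Proof.
move=> It PP.
have eH : mtrace (M := M) (hessian (M := M) (N := N) phi
    (tension (M := M) (N := N) phi)) (t, P) =
    tensmx (frame_laplacian gamma nu kappa t) P + \sum_(k : 'I_n * 'I_n * bool)
      - (cmx_dot (PC_tproj P (cmx_basis R k)) (PC_tproj P (cmx_basis R k)) *:
        (tensmx (kappa t *: nu t) P : EN)).
  apply: (etrans (mtrace_prod _ _)).
  refine (congr2 (fun u v : EN => u + v) (hessian_X0 It PP) _).
  apply: eq_bigr => k _.
  have tc s : I s -> PC_tproj (gamma s) (frame gamma nu (cst 0) kappa s) =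
    frame gamma nu (cst 0) kappa s := @frame_tangent _ _ s.
  apply: (etrans (hessian_XP _ It PP tension_frame_phi tc)).
  by rewrite -(tension_frame_phi (q := (t, P)) (conj It PP)) (tension_phi It PP).
have eR : mtrace (M := M) (fun X Y q => curvature (M := N) (phi q)
    (dmap (M := M) (N := N) phi X q) (tension (M := M) (N := N) phi q)
    (dmap (M := M) (N := N) phi Y q)) (t, P) =
    tensmx ((- (4 * kappa t)) *: nu t) P + \sum_(k : 'I_n * 'I_n * bool)
      - (cmx_dot (PC_tproj P (cmx_basis R k)) (PC_tproj P (cmx_basis R k)) *:
        (tensmx (kappa t *: nu t) P : EN)).
  apply: (etrans (mtrace_prod _ _)).
  refine (congr2 (fun u v : EN => u + v) (curvature_X0 It PP) _).
  by apply: eq_bigr => k _; exact: (curvature_XP _ It PP).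
apply: (etrans (congr2 (fun u v : EN => - - u - v) eH eR)).
rewrite opprK opprD addrACA subrr addr0 scaleNr tensmxNl opprK.
exact: (esym (tensmxDl _ _ _)).
Qed.

End Segre.

(** ** The tangential part *)

Section Tangential.
Variables (R : realType) (I : set R) (I_open : open I) (n : nat).
Variable gamma : R -> ambient (PC R 2).
Hypothesis gamma_unit : unit_speed_curve I gamma.
Local Notation C := R[i].
Local Notation EN := (cmx_euclid R (2 * n)).
Local Notation T := (ederiv gamma).
Local Notation M := (manifold_prod (open_interval I_open) (PC R n)).
Local Notation N := (PC R (2 * n)).
Let phi : ambient M -> ambient N := fun p => segre (gamma p.1, p.2).

Lemma cmx_dot_tens (A B : cmx R 2) (D F : cmx R n) :
  cmx_dot (tensmx A D) (tensmx B F) =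
  2^-1 * complex.Re (\tr (A *m ctr B) * \tr (D *m ctr F)).
Proof. by rewrite /cmx_dot ctr_tens tensmx_mul mxtrace_tens. Qed.

Variables (t : R) (P : cmx R n).
Hypotheses (It : I t) (PP : points (PC R n) P).
Let Pg : points (PC R 2) (gamma t) := gamma_point gamma_unit It.

Lemma cmx_dot_tensr (A B : cmx R 2) :
  cmx_dot (tensmx A P) (tensmx B P) = cmx_dot A B.
Proof.
by rewrite cmx_dot_tens (point_ctr PP) (point_id PP) (point_tr PP) mulr1.
Qed.

Lemma cmx_dot_tensl (D F : cmx R n) :
  cmx_dot (tensmx (gamma t) D) (tensmx (gamma t) F) = cmx_dot D F.
Proof.
by rewrite cmx_dot_tens (point_ctr Pg) (point_id Pg) (point_tr Pg) mul1r.
Qed.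

Lemma point_tr_tangent k (S X : cmx R k) : points (PC R k) S ->
  PC_tproj S X = X -> \tr (S *m X) = 0.
Proof.
move=> PS tX; have [_ sX] := (tangentP PS X).1 tX.
rewrite -(point_id PS) -mulmxA mxtrace_mulC (tangent_compress0 (point_id PS) sX).
exact: mxtrace0.
Qed.

Lemma tangentialE (V : ambient M -> EN) :
  tangential (M := M) (N := N) phi V (t, P) =
  edot (V (t, P)) (tensmx (T t) P : EN) *: (tensmx (T t) P : EN) +
  \sum_k edot (V (t, P)) (tensmx (gamma t) (PC_tproj P (cmx_basis R k)) : EN) *:
    (tensmx (gamma t) (PC_tproj P (cmx_basis R k)) : EN).
Proof.
apply: (etrans (mtrace_prod _ _)).
pose f (W : EN) := edot (V (t, P)) W *: W.
refine (congr2 (fun u v : EN => u + v) (congr1 f (dmap_X0 I_open gamma_unit It PP)) _).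
apply: eq_bigr => k _.
exact: (congr1 f (dmap_XP I_open gamma_unit It PP _)).
Qed.

(** A field tangent to the first factor is orthogonal to the second one, because
the trace of [P Y] vanishes for [Y] tangent at [P]. *)
Lemma tangential_tens (V : ambient M -> EN) (A : cmx R 2) :
  V (t, P) = tensmx A P ->
  tangential (M := M) (N := N) phi V (t, P) =
  cmx_dot A (T t) *: (tensmx (T t) P : EN).
Proof.
move=> eV; apply: (etrans (tangentialE _)).
have e1 : edot (V (t, P)) (tensmx (T t) P : EN) = cmx_dot A (T t).
  by rewrite eV; exact: cmx_dot_tensr.
rewrite e1 big1 ?addr0 // => k _.
set Y := PC_tproj P _; have tY : PC_tproj P Y = Y := tangent_tproj PP _.
have [hY _] := (tangentP PP Y).1 tY.
have -> : edot (V (t, P)) (tensmx (gamma t) Y : EN) = 0.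
  rewrite eV; apply: (etrans (cmx_dot_tens _ _ _ _)).
  by rewrite hY (point_tr_tangent PP tY) mulr0 /= mulr0.
exact: scale0r.
Qed.

(** Each term of the inner products has a vanishing trace in one of its factors,
so the mixed vectors are normal to the product. *)
Lemma tangential_mixed (V : ambient M -> EN) (c : cmx R 2) (A : cmx R n) :
  PC_tproj (gamma t) c = c -> PC_tproj P A = A ->
  V (t, P) = tensmx (gamma t *m c) (P *m A) + tensmx (c *m gamma t) (A *m P) ->
  tangential (M := M) (N := N) phi V (t, P) = 0.
Proof.
move=> tc tA eV; apply: (etrans (tangentialE _)).
have trA := point_tr_tangent PP tA; have trc := point_tr_tangent Pg tc.
have gg := point_id Pg; have PPP := point_id PP.
have hP := point_ctr PP; have hg := point_ctr Pg.
have [_ sc] := (tangentP Pg c).1 tc; have [_ sA] := (tangentP PP A).1 tA.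
have e1 : edot (V (t, P)) (tensmx (T t) P : EN) = 0.
  rewrite eV; apply: (etrans (cmx_dotDl _ _ _)); rewrite !cmx_dot_tens hP.
  rewrite (tangent_compress0 PPP sA) mxtrace0 -(mulmxA A) PPP (mxtrace_mulC A) trA.
  by rewrite !mulr0 addr0.
rewrite e1 big1 ?scale0r ?addr0 // => k _.
set Y := PC_tproj P _.
have -> : edot (V (t, P)) (tensmx (gamma t) Y : EN) = 0.
  rewrite eV; apply: (etrans (cmx_dotDl _ _ _)); rewrite !cmx_dot_tens hg.
  rewrite (tangent_compress0 gg sc) mxtrace0 -(mulmxA c) gg (mxtrace_mulC c) trc.
  by rewrite !mul0r ?mulr0 addr0.
exact: scale0r.
Qed.

(** Multiplied by the point on the left and by the tensor product of [c] and [A]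
on the right, the mixed vector becomes [|c|^2 |A|^2] times the point. *)
Lemma mixed_eq0 (c : cmx R 2) (A : cmx R n) :
  PC_tproj (gamma t) c = c -> PC_tproj P A = A ->
  tensmx (gamma t *m c) (P *m A) + tensmx (c *m gamma t) (A *m P) = 0 ->
  cmx_dot c c * cmx_dot A A = 0.
Proof.
move=> tc tA W0; have gg := point_id Pg; have PPP := point_id PP.
have [_ sc] := (tangentP Pg c).1 tc; have [_ sA] := (tangentP PP A).1 tA.
have [ec _] := point_compress_sqr Pg tc; have [eA _] := point_compress_sqr PP tA.
have : tensmx (gamma t) P *m (tensmx (gamma t *m c) (P *m A) +
    tensmx (c *m gamma t) (A *m P)) *m tensmx c A = 0.
  by rewrite W0 mulmx0 mul0mx.
rewrite mulmxDr mulmxDl !tensmx_mul !mulmxA gg PPP.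
rewrite (tangent_compress0 gg sc) mul0mx tens0mx addr0 ec eA.
rewrite tensmxZl tensmxZr => /(congr1 (@mxtrace _ _)).
rewrite !mxtraceZ mxtrace_tens (point_tr Pg) (point_tr PP) !mulr1 mxtrace0 -rmorphM.
by move=> /(congr1 (@complex.Re R)).
Qed.

(** ** The complex structure *)

Lemma PC_J_tens (A : cmx R n) :
  PC_J (tensmx (gamma t) P : cmx R (2 * n)) (tensmx (gamma t) A) =
  tensmx (gamma t) (PC_J P A).
Proof.
rewrite /PC_J !tensmx_mul (point_id Pg); apply: esym.
by apply: (etrans (tensmxZr _ _ _)); rewrite tensmxBr.
Qed.

(** With [u] the imaginary unit, this compares the squares of [X] and of its image
under the complex structure, hence their norms. *)
Lemma rotation_sqr (F : comNzRingType) k (u : F) (S X : 'M[F]_k) :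
  u * u = - 1 -> S *m S = S -> S *m X *m S = 0 ->
  S *m (u *: (X *m S - S *m X)) *m (u *: (X *m S - S *m X)) = S *m X *m X *m S.
Proof.
move=> uu SS SXS.
rewrite -!scalemxAr -!scalemxAl scalerA uu scaleN1r.
have -> : S *m (X *m S - S *m X) = - (S *m X).
  by rewrite mulmxBr !mulmxA SXS SS sub0r.
by rewrite mulNmx opprK mulmxBr !mulmxA SXS mul0mx subr0.
Qed.

Lemma PC_J_tangent (A : cmx R n) : PC_tproj P A = A ->
  PC_tproj P (PC_J P A) = PC_J P A /\
  cmx_dot (PC_J P A) (PC_J P A) = cmx_dot A A.
Proof.
move=> tA; have [hA sA] := (tangentP PP A).1 tA.
have PPP := point_id PP; have hP := point_ctr PP.
have PAP := tangent_compress0 PPP sA.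
have tJ : PC_tproj P (PC_J P A) = PC_J P A.
  apply/(tangentP PP); rewrite /PC_J; split.
    rewrite ctrZ ctrB !ctrM hA hP -[P *m A - _]opprB scalerN -scaleNr; congr (_ *: _).
    by apply/eqP; rewrite eq_complex /= oppr0 opprK !eqxx.
  rewrite -scalemxAl -scalemxAr -scalerDr; congr (_ *: _).
  rewrite mulmxBl mulmxBr !mulmxA PPP PAP -mulmxA PPP subr0 sub0r; exact.
split; first exact: tJ.
have [eJ _] := point_compress_sqr PP tJ; have [eA _] := point_compress_sqr PP tA.
have ii : 'i%C * 'i%C = - 1 :> C.
  by apply/eqP; rewrite eq_complex /= !mulr0 !mul0r !mulr1 sub0r addr0 oppr0 !eqxx.
have e := rotation_sqr ii PPP PAP.
have e2 : P *m A *m A *m P = ((cmx_dot A A)%:C)%C *: (P : 'M[C]_n).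
  by rewrite eA -scalemxAl PPP.
have := etrans (esym (etrans e e2)) eJ.
move=> /(congr1 (@mxtrace _ _)); rewrite !mxtraceZ (point_tr PP) !mulr1.
by move=> /(congr1 (@complex.Re R)).
Qed.

End Tangential.

(** * Curves with constant curvature *)

Section ConstantCurvature.
Variables (R : realType) (I : set R) (I_open : open I).
Hypothesis I_interval : is_interval I.
Variables (gamma nu : R -> ambient (PC R 2)) (kappa : R -> R).
Hypothesis gamma_unit : unit_speed_curve I gamma.
Hypothesis gamma_frenet : frenet I gamma nu kappa.
Hypothesis kappa_neq0 : forall t, I t -> kappa t <> 0.
Local Notation E := (cmx_euclid R 2).
Local Notation T := (ederiv gamma).
Local Notation kappa' := (derive1 kappa).
Local Notation kappa'' := (derive1 (derive1 kappa)).

Lemma kappa_constant_iff :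
  (exists c, forall t, I t -> kappa t = c) <-> (forall t, I t -> kappa' t = 0).
Proof.
have dk := is_derive_kappa I_open gamma_unit gamma_frenet.
split=> [[c kc] t It|k0].
  exact: (is_derive_constant_on I_open It kc (dk t It)).
have mono a b : I a -> I b -> a <= b -> kappa b = kappa a.
  move=> Ia Ib ab; have Iab z : a <= z <= b -> I z by exact: I_interval.
  have [z||z] := @MVT_segment R kappa kappa' a b ab.
  - by rewrite in_itv /= => /andP[az zb]; apply: dk; apply: Iab; rewrite !ltW.
  - apply: derivable_within_continuous => z; rewrite in_itv /= => /Iab /dk d.
    exact: (@ex_derive _ _ _ _ _ _ _ d).
  - rewrite in_itv /= => /Iab /k0 -> /eqP.
    by rewrite mul0r subr_eq0 => /eqP.
have [[t0 I0]|I0] := pselect (exists t, I t); last first.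
  by exists 0 => t It; case: I0; exists t.
exists (kappa t0) => t It; have [tt|/ltW tt] := leP t t0; last exact: mono.
by rewrite (mono t t0).
Qed.

Lemma edot_frame (a b : R) t : I t ->
  edot (a *: T t + b *: nu t) (T t) = a /\ edot (a *: T t + b *: nu t) (nu t) = b.
Proof.
move=> It; have nT := edot_nuT gamma_frenet It.
have Tn : edot (T t) (nu t) = 0 := etrans (edotC _ _) nT.
have TT := edot_TT gamma_unit It; have nn := edot_nunu gamma_frenet It.
split; apply: (etrans (edotDl _ _ _)); rewrite !edotZl.
  by rewrite TT nT mulr1 mulr0 addr0.
by rewrite Tn nn mulr1 mulr0 add0r.
Qed.

(** The bitension field of [gamma]; the last term comes from the curvature 4 of
the projective line. *)
Definition curve_bitension t : E :=
  frame_laplacian gamma nu kappa t + (4 * kappa t) *: nu t.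

Lemma curve_bitensionE t : curve_bitension t =
  (- (3 * kappa t * kappa' t)) *: T t +
  (kappa'' t - kappa t ^+ 3 + 4 * kappa t) *: nu t.
Proof. by rewrite /curve_bitension /frame_laplacian -addrA -scalerDl. Qed.

Lemma edot_curve_bitension t : I t ->
  edot (curve_bitension t) (T t) = - (3 * kappa t * kappa' t).
Proof. by move=> It; rewrite curve_bitensionE; exact: (edot_frame _ _ It).1. Qed.

Lemma tangential_eq0 t : I t -> - (3 * kappa t * kappa' t) = 0 -> kappa' t = 0.
Proof.
move=> It /eqP; rewrite oppr_eq0 -mulrA mulf_eq0 pnatr_eq0 /=.
by rewrite mulf_eq0 => /orP[/eqP/(kappa_neq0 It)|/eqP].
Qed.

Lemma kappa''_eq0 : (forall t, I t -> kappa' t = 0) ->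
  forall t, I t -> kappa'' t = 0.
Proof.
move=> k0 t It.
exact: (is_derive_constant_on I_open It k0
  (is_derive_kappa' I_open gamma_unit gamma_frenet It)).
Qed.

Lemma curve_bitension_eq0 :
  (forall t, I t -> curve_bitension t = 0) <-> (forall t, I t -> kappa t ^+ 2 = 4).
Proof.
split=> [B0|k4].
  have k0 t : I t -> kappa' t = 0.
    move=> It; apply: tangential_eq0 => //.
    by rewrite -edot_curve_bitension // B0 // edot0.
  move=> t It; have := (edot_frame (- (3 * kappa t * kappa' t))
    (kappa'' t - kappa t ^+ 3 + 4 * kappa t) It).2.
  rewrite -curve_bitensionE B0 // edot0 (kappa''_eq0 k0 It) => e.
  have kn : kappa t != 0 by apply/eqP; exact: kappa_neq0.
  apply: (mulfI kn); apply/eqP; rewrite -subr_eq0 -oppr_eq0 [in X in _ == X]e.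
  by apply/eqP; ring.
have k0 t : I t -> kappa' t = 0.
  move=> It; have dk := is_derive_kappa I_open gamma_unit gamma_frenet It.
  have e := is_derive_constant_on I_open It k4 (is_deriveX 2 dk).
  move/eqP: e; rewrite /GRing.scale /= expr1 mulf_eq0 mulf_eq0 pnatr_eq0 /=.
  by move=> /orP[/eqP/(kappa_neq0 It)|/eqP].
move=> t It; rewrite curve_bitensionE (k0 t It) (kappa''_eq0 k0 It).
have -> : - (3 * kappa t * 0) = 0 :> R by rewrite mulr0 oppr0.
have -> : 0 - kappa t ^+ 3 + 4 * kappa t = 0 by rewrite exprS k4 //; ring.
by rewrite !scale0r addr0.
Qed.

Lemma kappa_nu_neq0 t : I t -> kappa t *: nu t != 0.
Proof.
move=> It; apply/eqP => e; apply: (kappa_neq0 It).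
have := edotZl (kappa t) (nu t) (nu t).
by rewrite e edot0 (edot_nunu gamma_frenet It) mulr1.
Qed.

End ConstantCurvature.

(** * The Segre image of a curve times a projective space *)

Section Conclusions.
Variables (R : realType) (q : nat) (I : set R) (I_open : open I).
Hypothesis I_neq0 : I !=set0.
Variables (gamma nu : R -> ambient (PC R 2)) (kappa : R -> R).
Hypothesis gamma_unit : unit_speed_curve I gamma.
Hypothesis gamma_frenet : frenet I gamma nu kappa.
Hypothesis kappa_neq0 : forall t, I t -> kappa t <> 0.
Local Notation E := (cmx_euclid R 2).
Local Notation EN := (cmx_euclid R (2 * q.+1)).
Local Notation T := (ederiv gamma).
Local Notation M := (manifold_prod (open_interval I_open) (PC R q.+1)).
Local Notation N := (PC R (2 * q.+1)).
Local Notation kappa' := (derive1 kappa).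
Local Notation B := (curve_bitension gamma nu kappa).
Let gammaI : ambient (open_interval I_open) -> ambient (PC R 2) := gamma.
Let phi : ambient M -> ambient N := fun p => segre (gamma p.1, p.2).

Lemma exists_point : exists P, points (PC R q.+1) P.
Proof.
exists (line (const_mx 1)); exists (const_mx 1) => //.
by apply/eqP => /matrixP /(_ ord0 ord0); rewrite !mxE => /eqP; rewrite oner_eq0.
Qed.

Lemma tens_eq0 (A : cmx R 2) (P : cmx R q.+1) : points (PC R q.+1) P ->
  tensmx A P = 0 -> A = 0.
Proof.
move=> PP AP0; apply: (@edot_eq0 R E).
apply: (etrans (esym (cmx_dot_tensr PP A A))); rewrite AP0.
exact: (@edot0 R EN).
Qed.

Lemma bitension_phiE t P : I t -> points (PC R q.+1) P ->
  bitension (M := M) (N := N) phi (t, P) = tensmx (B t) P.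
Proof. by move=> It PP; exact: (bitension_phi I_open gamma_unit gamma_frenet It PP). Qed.

(** The tangential part of the bitension field is [- 3 kappa kappa'] times the
unit tangent vector of the curve, and [kappa] has no zero. *)
Lemma biconservative_iff : biconservative (M := M) (N := N) phi <->
  forall t, I t -> kappa' t = 0.
Proof.
have tang t P (It : I t) (PP : points (PC R q.+1) P) :
    tangential (M := M) (N := N) phi (bitension (M := M) (N := N) phi) (t, P) =
    (- (3 * kappa t * kappa' t)) *: (tensmx (T t) P : EN).
  apply: (etrans (tangential_tens gamma_unit It PP (bitension_phiE It PP))).
  exact: (congr1 ( *:%R^~ _) (edot_curve_bitension gamma_unit gamma_frenet It)).
split=> [bc t It|k0 [t P] [It PP]].
  have [P PP] := exists_point.
  apply: (tangential_eq0 kappa_neq0 It).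
  have := bc (t, P) (conj It PP); rewrite (tang t P It PP) => /eqP.
  rewrite scaler_eq0 => /orP[/eqP //|/eqP /(tens_eq0 PP) T0].
  have := edot_TT gamma_unit It; rewrite T0 edot0 => /esym/eqP.
  by rewrite oner_eq0.
by rewrite (tang t P It PP) (k0 t It) mulr0 oppr0 scale0r.
Qed.

Lemma mean_curvature_phi t P : I t -> points (PC R q.+1) P ->
  mean_curvature (M := M) (N := N) phi (t, P) =
  tensmx ((mdim M)%:R^-1 *: (kappa t *: nu t)) P.
Proof.
move=> It PP; apply: (etrans (congr1 _ (tension_phi I_open gamma_unit gamma_frenet It PP))).
exact: (esym (tensmxZl _ _ _)).
Qed.

(** The mean curvature is [|kappa|] divided by the dimension. *)
Lemma CMC_phi : (exists c, forall t, I t -> kappa t = c) ->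
  CMC (M := M) (N := N) phi.
Proof.
move=> [c kc]; exists (Num.sqrt ((mdim M)%:R^-1 * ((mdim M)%:R^-1 * (c * c)))).
move=> [t P] [It PP]; rewrite /enorm (mean_curvature_phi It PP); congr Num.sqrt.
apply: (etrans (cmx_dot_tensr PP _ _)).
apply: (etrans (edotZl (e := E) _ _ _)); rewrite [edot _ _](edotZr (E := E)).
rewrite [edot _ _](edotZl (e := E)) [edot (nu t) _](edotZr (E := E)).
by rewrite (edot_nunu gamma_frenet It) mulr1 kc.
Qed.

Lemma exists_tangent P : (1 <= q)%N -> points (PC R q.+1) P ->
  exists y, cmx_dot (PC_tproj P y) (PC_tproj P y) != 0.
Proof.
move=> q1 PP; apply: contrapT => no.
have := sum_tproj_sqr PP; rewrite big1 => [/esym/eqP|k _].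
  rewrite -[q.+1%:R]natr1 addrK mulf_eq0 !pnatr_eq0 /= => /eqP q0.
  by rewrite q0 in q1.
by apply/eqP/negPn/negP => h; apply: no; exists (cmx_basis R k).
Qed.

(** Moved along a tangent vector [Y] of the projective factor, the mean curvature
vector changes by the mixed vector of itself and [Y], which is normal and not
zero. *)
Lemma not_PMC_phi : (1 <= q)%N -> ~ PMC (M := M) (N := N) phi.
Proof.
move=> q1 pmc; have [t It] := I_neq0; have [P PP] := exists_point.
have [y /eqP] := exists_tangent q1 PP; apply.
pose c s : E := (mdim M)%:R^-1 *: (kappa s *: nu s).
have Hc p : points M p ->
    mean_curvature (M := M) (N := N) phi p = tensmx (c p.1) p.2.
  by case: p => s Q [Is PQ]; exact: mean_curvature_phi.
have Pg := gamma_point gamma_unit It.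
have tc : PC_tproj (gamma t) (c t) = c t.
  have [_ pZ] := tproj_linear (gamma t).
  apply: (etrans (pZ _ _)); apply: (congr1 ( *:%R _)); apply: (etrans (pZ _ _)).
  exact: (congr1 ( *:%R _) (nu_tangent gamma_frenet It)).
have tY := tangent_tproj PP y.
have e := pconn_tens0 gamma_unit It PP Hc tc
  (erefl : tfield (M := M) (0 : R, y : cmx R q.+1) (t, P) = _) tY.
have := pmc (t, P) (0, y) (conj It PP); rewrite /normal_conn.
rewrite (tangential_mixed gamma_unit It PP tc tY e) subr0 e => W0.
have := mixed_eq0 gamma_unit It PP tc tY W0.
move=> /eqP; rewrite mulf_eq0 => /orP[/eqP cc0|/eqP //].
have : c t = 0 := edot_eq0 (E := E) cc0.
move=> /eqP; rewrite scaler_eq0 (negbTE (kappa_nu_neq0 gamma_frenet kappa_neq0 It)).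
by rewrite orbF invr_eq0 pnatr_eq0.
Qed.

(** The projective factor is a complex submanifold: the image of [Y] under the
complex structure is again tangent to it. *)
Lemma not_totally_real_phi : (1 <= q)%N ->
  ~ totally_real (M := M) (N := N) (@PC_J R (2 * q.+1)) phi.
Proof.
move=> q1 tr; have [t It] := I_neq0; have [P PP] := exists_point.
have [y /eqP] := exists_tangent q1 PP; apply.
have tY := tangent_tproj PP y; set Y := PC_tproj P y in tY *.
have [tJ dJ] := PC_J_tangent PP tY.
have e1 := dmap_XP I_open gamma_unit It PP y.
have e2 := etrans (dmap_XP I_open gamma_unit It PP (PC_J P Y))
  (congr1 (fun A => tensmx (gamma t) A : cmx R (2 * q.+1)) tJ).
pose f (W W' : EN) := edot (PC_J (tensmx (gamma t) P : cmx R (2 * q.+1)) W : EN) W'.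
have f0 := etrans (esym (congr2 f e1 e2)) (tr (t, P) (0, y) (0, PC_J P Y) (conj It PP)).
have eJ := congr1 (fun W : EN => edot W (tensmx (gamma t) (PC_J P Y) : EN))
  (PC_J_tens gamma_unit P It Y).
have := etrans (esym eJ) f0.
by move=> /(etrans (esym (cmx_dot_tensl gamma_unit It _ _))); rewrite dJ.
Qed.

Lemma proper_biharmonic_phi_iff : proper_biharmonic (M := M) (N := N) phi <->
  forall t, I t -> kappa t ^+ 2 = 4.
Proof.
have [P PP] := exists_point; have [t0 I0] := I_neq0.
have B0 := curve_bitension_eq0 I_open gamma_unit gamma_frenet kappa_neq0.
split=> [[bi _]|/B0 k4].
  apply/B0 => t It; apply: (tens_eq0 PP).
  by rewrite -(bitension_phiE It PP); exact: (bi (t, P) (conj It PP)).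
split=> [[t Q] [It PQ]|har].
  by rewrite (bitension_phiE It PQ) (k4 t It); exact: tens0mx.
have := har (t0, P) (conj I0 PP).
rewrite (tension_phi I_open gamma_unit gamma_frenet I0 PP) => /(tens_eq0 PP) /eqP.
exact: (negP (kappa_nu_neq0 gamma_frenet kappa_neq0 I0)).
Qed.

Lemma proper_biharmonic_gamma_iff :
  proper_biharmonic (M := open_interval I_open) (N := PC R 2) gammaI <->
  forall t, I t -> kappa t ^+ 2 = 4.
Proof.
have [t0 I0] := I_neq0.
have B0 := curve_bitension_eq0 I_open gamma_unit gamma_frenet kappa_neq0.
have bE := bitension_gammaI I_open gamma_unit gamma_frenet.
split=> [[bi _]|/B0 k4].
  by apply/B0 => t It; apply: (etrans (esym (bE t It))); exact: bi.
split=> [t It|har]; first exact: (etrans (bE t It) (k4 t It)).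
have := har t0 I0; rewrite (tension_gammaI I_open gamma_unit gamma_frenet I0) => /eqP.
exact: (negP (kappa_nu_neq0 gamma_frenet kappa_neq0 I0)).
Qed.

End Conclusions.

Theorem theorem6p1 (R : realType) (q : nat) (q_ge1 : (1 <= q)%N)
  (I : set R) (I_open : open I) (I_interval : is_interval I) (I_neq0 : I !=set0)
  (gamma nu : R -> ambient (PC R 2)) (kappa : R -> R)
  (gamma_unit : unit_speed_curve I gamma)
  (gamma_frenet : frenet I gamma nu kappa)
  (kappa_neq0 : forall t, I t -> kappa t <> 0) :
  let gammaI : ambient (open_interval I_open) -> ambient (PC R 2) := gamma in
  let M := manifold_prod (open_interval I_open) (PC R q.+1) in
  let phi : ambient M -> ambient (PC R (2 * q.+1)) :=
    fun p => segre (gamma p.1, p.2) in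
  let kappa_constant := exists c : R, forall t, I t -> kappa t = c in
  let kappa_sqr_eq4 := forall t, I t -> kappa t ^+ 2 = 4 in
  [/\ biconservative phi <-> kappa_constant,
      biconservative phi ->
        [/\ CMC phi, ~ PMC phi & ~ totally_real (N := PC R (2 * q.+1)) (@PC_J R (2 * q.+1)) phi],
      proper_biharmonic phi <-> kappa_sqr_eq4 &
      kappa_sqr_eq4 <-> proper_biharmonic gammaI].
Proof.
move=> gammaI M phi kappa_constant kappa_sqr_eq4.
have bcP : biconservative phi <-> kappa_constant.
  apply: (iff_trans (biconservative_iff _ I_open gamma_unit gamma_frenet kappa_neq0)).
  apply: iff_sym.
  exact: (kappa_constant_iff I_open I_interval gamma_unit gamma_frenet).
split.
- exact: bcP.
- move=> /bcP kc; split.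
  + exact: (CMC_phi _ I_open gamma_unit gamma_frenet kc).
  + exact: (not_PMC_phi I_neq0 gamma_unit gamma_frenet kappa_neq0 q_ge1).
  + exact: (not_totally_real_phi I_neq0 gamma_unit q_ge1).
- exact: (proper_biharmonic_phi_iff _ I_open I_neq0 gamma_unit gamma_frenet kappa_neq0).
- apply: iff_sym.
  exact: (proper_biharmonic_gamma_iff I_open I_neq0 gamma_unit gamma_frenet kappa_neq0).
Qed.
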